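(* For every integer $r\ge3$ there is $\epsilon=\epsilon(r)>0$ such that the following holds. Let $K>0$ be a constant and let $p=p(n)$ satisfy $n^{-1/m(K_r)}\ll p\le n^{-\frac{1}{m_2(K_r)}}(\log n)^{\frac{4r}{e(K_r)-1}}$. Then for every sufficiently large integer $n$, letting $\tilde n\le n/r$ be the largest integer satisfying $\tilde n^{\,r-2}p^{\binom r2-1}<(\log n)^{-10}$, for every $t\in[0,\pi\sigma_r]$ we have $$\left|\mathbb{E}\left[e^{it\cdot X_r/\sigma_r}\right]\right|\le n^{-K}+\exp\left(-\frac{\epsilon\,\tilde n^{\,r}p^{\binom r2}t^2}{\sigma_r^2}\right).$$
   Context: $G_{n,p}$ is the binomial random graph on $[n]$ with edge probability $p$. $X_r$ is the number of copies of $K_r$ in $G_{n,p}$ (the number of $r$-element vertex subsets inducing a clique), and $\sigma_r$ is its standard deviation. $m(K_r)=\frac{r-1}{2}$, $m_2(K_r)=\frac{r+1}{2}$, $e(K_r)=\binom r2$. The notation $f\ll g$ means $f(n)/g(n)\to0$ as $n\to\infty$. *)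

(* Defs.v *)
From mathcomp Require Import all_boot all_order all_algebra.
From mathcomp Require Import all_classical all_reals all_analysis.
From mathcomp Require Import complex.

Set Implicit Arguments.
Unset Strict Implicit.
Unset Printing Implicit Defensive.

Import Order.TTheory GRing.Theory Num.Theory.
Import numFieldNormedType.Exports.

Local Open Scope ring_scope.

(* A graph on the vertex set 'I_n is identified with its edge set, a set of
   two-element subsets of 'I_n. *)
Definition pairs (n : nat) : {set {set 'I_n}} := [set e : {set 'I_n} | #|e| == 2%N].

Definition graphs (n : nat) : {set {set {set 'I_n}}} := powerset (pairs n).

Definition is_clique (n : nat) (G : {set {set 'I_n}}) (S : {set 'I_n}) : bool :=
  [forall u in S, forall v in S, (u != v) ==> ([set u; v] \in G)].

Definition num_cliques (r n : nat) (G : {set {set 'I_n}}) : nat :=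
  #|[set S : {set 'I_n} | (#|S| == r) && is_clique G S]|.

Local Open Scope classical_set_scope.
Local Open Scope ring_scope.

Section Gnp.
Variable R : realType.

Definition gnp_prob (n : nat) (p : R) (G : {set {set 'I_n}}) : R :=
  p ^+ #|G| * (1 - p) ^+ #|pairs n :\: G|.

Definition gnp_expect (n : nat) (p : R) (f : {set {set 'I_n}} -> R) : R :=
  \sum_(G in graphs n) gnp_prob p G * f G.

Definition gnp_expectC (n : nat) (p : R) (f : {set {set 'I_n}} -> R[i]) : R[i] :=
  \sum_(G in graphs n) (gnp_prob p G)%:C%C * f G.

Definition mean_cliques (r n : nat) (p : R) : R :=
  gnp_expect p (fun G : {set {set 'I_n}} => (num_cliques r G)%:R).

Definition sd_cliques (r n : nat) (p : R) : R :=
  Num.sqrt (gnp_expect p (fun G : {set {set 'I_n}} =>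
    ((num_cliques r G)%:R - mean_cliques r n p) ^+ 2)).

(* e^{ix} for real x, by Euler's formula *)
Definition expi (x : R) : R[i] := (cos x +i* sin x)%C.

(* E[e^{i t X_r / sigma_r}] *)
Definition char_cliques (r n : nat) (p t : R) : R[i] :=
  gnp_expectC p (fun G : {set {set 'I_n}} =>
    expi (t * (num_cliques r G)%:R / sd_cliques r n p)).

Definition mK (r : nat) : R := (r%:R - 1) / 2.

Definition m2K (r : nat) : R := (r%:R + 1) / 2.

(* f << g.  As x / 0 = 0, the ratio alone would not exclude zeros of g. *)
Definition much_less (f g : nat -> R) : Prop :=
  (\forall n \near \oo, g n != 0) /\ f n / g n @[n --> \oo] --> 0.

(* The largest integer m <= n / r with
   m^(r-2) p^(binom(r,2)-1) < (log n)^(-10).  For r >= 3 and n >= 2 the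
   integer m = 0 qualifies, so the maximum is over a nonempty set. *)
Definition ntilde (r n : nat) (p : R) : nat :=
  (\max_(m < (n %/ r).+1 |
      (m%:R ^+ (r - 2) * p ^+ ('C(r, 2) - 1) < (ln (n%:R : R)) ^- 10)%R) m)%N.

End Gnp.

(* Main.v *)
Require Import Defs.
From mathcomp Require Import all_boot all_order all_algebra.
From mathcomp Require Import all_classical all_reals all_analysis.
From mathcomp Require Import complex ring lra zify.
Import Order.TTheory GRing.Theory Num.Theory.
Import numFieldNormedType.Exports.
From mathcomp Require Import fintype finset.
Set Implicit Arguments.
Unset Strict Implicit.
Unset Printing Implicit Defensive.
Local Open Scope ring_scope.

(** Let [X] be the number of copies of [K_r], [s = t / sigma_r], which lies in
    [[0, pi]], [N] the value of [ntilde], [C = 'C(r, 2)] and [q = 2 p (1 - p)].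

    Choose [r] disjoint classes of [N] vertices each.  The potential edges
    between two classes form a block, one for each of the [C] pairs of classes.
    Conditionally on the edges outside a block, the squared modulus of the mean
    of [exp (i s X)] is the mean of [exp (i s (X - X'))], where [X'] is computed
    after resampling the block; outside, Cauchy-Schwarz applies
    ([decoupling_step]).  Doing this for all the blocks raises the modulus to the
    power [2 ^ C] and turns [X] into an alternating sum over the resamplings.
    A clique without an edge in some block cancels, so only the cliques with
    one vertex in each class survive, and they contribute
    [\prod_e (x_e - x'_e)] over their [C] edges ([normc_le_alt_count]).

    Keep one block [D0] for the end.  Given the other blocks, the alternating
    sum is [\sum_e y_e W_e] with independent [y_e] in [{-1, 0, 1}], nonzero with
    probability [q], where [e] runs over the edges of the block [D0] and [W_e] is
    a signed count of the ways to complete [e].  Hence its characteristic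
    function is the mean of [\prod_e (1 - q (1 - cos (s W_e)))]
    ([mean_cos_alt_count]).  All factors are at most [1], and an edge with
    exactly one completion contributes [1 - q (1 - cos s)], where
    [1 - cos s >= c s ^ 2] for [s] in [[0, pi]].  It is here that
    uniqueness matters: for [s] close to [pi], an even [W_e] would give nothing.

    It remains to see that, up to a probability smaller than any power of [n],
    at least [mu / 4] edges of the block have exactly one completion, where
    [mu = N ^ r q ^ (C - 1)] is the mean number of spines: a spine is a
    transversal clique without its edge in [D0].  That number is at least the
    number of spines minus the number of ordered pairs of distinct spines over the
    same edge ([ext_num_count]).
    - The number of spines has a lower tail of Janson type ([lower_tail]).  The
      lower threshold on [p] makes every part of a spine that contains an edge
      have many copies, so that overlapping spines hardly correlate.
    - The number of pairs has an upper tail by a high moment ([moment_bound]).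
      Its mean is a small multiple of [mu] because [N] was chosen such that an
      edge has few completions on average; conditioning on the edges of as
      many pairs as the order of the moment adds to it, relative to [mu], only a
      power of that order times a negative power of [n].

    Both errors are exponentially small in a power of [n]
    ([spine_count_lower], [twin_count_upper]).  The [2 ^ C]-th root gives the
    theorem. *)

(** * Means of functions of independent coordinates *)

Section ProductMean.
Variable R : realType.

Definition iid_mean (E V : finType) (w : V -> R) (F : {ffun E -> V} -> R) : R :=
  \sum_(z : {ffun E -> V}) (\prod_e w (z e)) * F z.

Lemma eq_iid_mean (E V : finType) (w : V -> R) (F G : {ffun E -> V} -> R) :
  F =1 G -> iid_mean w F = iid_mean w G.
Proof. by move=> FG; apply: eq_bigr => z _; rewrite FG. Qed.

Lemma iid_mean_prod (E V : finType) (w : V -> R) (h : E -> V -> R) :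
  iid_mean w (fun z : {ffun E -> V} => \prod_e h e (z e)) =
  \prod_e \sum_v w v * h e v.
Proof.
rewrite bigA_distr_bigA; apply: eq_bigr => z _.
by rewrite -big_split.
Qed.

Lemma iid_meanZ (E V : finType) (w : V -> R) (c : R) (F : {ffun E -> V} -> R) :
  iid_mean w (fun z => c * F z) = c * iid_mean w F.
Proof. by rewrite /iid_mean big_distrr/=; apply: eq_bigr => z _; rewrite mulrCA. Qed.

Lemma iid_meanZr (E V : finType) (w : V -> R) (c : R) (F : {ffun E -> V} -> R) :
  iid_mean w (fun z => F z * c) = iid_mean w F * c.
Proof. by rewrite mulrC -iid_meanZ; apply: eq_iid_mean => z; rewrite mulrC. Qed.

Lemma iid_meanD (E V : finType) (w : V -> R) (F G : {ffun E -> V} -> R) :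
  iid_mean w (fun z => F z + G z) = iid_mean w F + iid_mean w G.
Proof. by rewrite /iid_mean -big_split; apply: eq_bigr => z _; rewrite mulrDr. Qed.

Lemma iid_meanB (E V : finType) (w : V -> R) (F G : {ffun E -> V} -> R) :
  iid_mean w (fun z => F z - G z) = iid_mean w F - iid_mean w G.
Proof.
rewrite iid_meanD -[in RHS]mulN1r -iid_meanZ; congr (_ + _).
by apply: eq_iid_mean => z; rewrite mulN1r.
Qed.

Lemma iid_mean_sum (E V I : finType) (w : V -> R) (P : pred I)
    (F : I -> {ffun E -> V} -> R) :
  iid_mean w (fun z => \sum_(i | P i) F i z) = \sum_(i | P i) iid_mean w (F i).
Proof.
rewrite /iid_mean exchange_big/=; apply: eq_bigr => z _.
by rewrite big_distrr.
Qed.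

(** Mapping independent coordinates one by one keeps them independent, so
    only the law of each coordinate has to be compared. *)
Lemma iid_mean_map (E V V' : finType) (w : V -> R) (w' : V' -> R)
    (g : E -> V -> V') (F : {ffun E -> V'} -> R) :
  (forall e u, \sum_(v | g e v == u) w v = w' u) ->
  iid_mean w (fun z : {ffun E -> V} => F [ffun e => g e (z e)]) = iid_mean w' F.
Proof.
move=> gw; rewrite /iid_mean.
rewrite (partition_big (fun z : {ffun E -> V} => [ffun e => g e (z e)]) predT)//=.
apply: eq_bigr => u _; under eq_bigr => z /eqP -> do [].
rewrite -big_distrl/=; congr (_ * _).
under [RHS]eq_bigr => e _ do rewrite -(gw e).
rewrite bigA_distr_big_dep; apply: eq_bigl => z.
apply/eqP/familyP => [<- e|h]; first by rewrite ffunE unfold_in.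
by apply/ffunP => e; rewrite ffunE; apply/eqP; have := h e; rewrite unfold_in.
Qed.

(** The law of a pair of independent coordinates. *)
Definition prodw (V V' : finType) (w : V -> R) (w' : V' -> R) (v : V * V') : R :=
  w v.1 * w' v.2.

Lemma iid_mean_pair (E V V' : finType) (w : V -> R) (w' : V' -> R)
    (F : {ffun E -> V} -> {ffun E -> V'} -> R) :
  iid_mean w (fun z => iid_mean w' (F z)) =
  iid_mean (prodw w w') (fun u : {ffun E -> V * V'} =>
    F [ffun e => (u e).1] [ffun e => (u e).2]).
Proof.
rewrite /iid_mean.
under eq_bigr do rewrite big_distrr.
rewrite pair_big/=.
pose h (u : {ffun E -> V * V'}) := ([ffun e => (u e).1], [ffun e => (u e).2]).
pose h' (p : {ffun E -> V} * {ffun E -> V'}) := [ffun e => (p.1 e, p.2 e)].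
rewrite (reindex h)/=; last first.
  exists h' => [u _|[a b] _].
    by apply/ffunP => e; rewrite !ffunE/=; case: (u e).
  by congr (_, _); apply/ffunP => e; rewrite !ffunE.
apply: eq_bigr => u _; rewrite mulrA -big_split/=; congr (_ * _).
by apply: eq_bigr => e _; rewrite !ffunE.
Qed.

Section Probability.
Variables (E V : finType) (w : V -> R).
Hypotheses (w_ge0 : forall v, 0 <= w v) (w_sum1 : \sum_v w v = 1).
Implicit Types F G : {ffun E -> V} -> R.

Lemma iid_mean_cst (c : R) : iid_mean w (fun _ : {ffun E -> V} => c) = c.
Proof.
rewrite /iid_mean -big_distrl/= -(bigA_distr_bigA (fun=> w)) big1 ?mul1r// => e _.
Qed.

Lemma le_iid_mean F G : (forall z, F z <= G z) -> iid_mean w F <= iid_mean w G.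
Proof. by move=> FG; apply: ler_sum => z _; rewrite ler_wpM2l// prodr_ge0. Qed.

Lemma iid_mean_ge0 F : (forall z, 0 <= F z) -> 0 <= iid_mean w F.
Proof. by move=> F0; rewrite sumr_ge0// => z _; rewrite mulr_ge0// prodr_ge0. Qed.

(** The Cauchy-Schwarz inequality, as positivity of the variance. *)
Lemma iid_mean_sqr_le F : iid_mean w F ^+ 2 <= iid_mean w (fun z => F z ^+ 2).
Proof.
set m := iid_mean w F.
have : 0 <= iid_mean w (fun z => (F z - m) ^+ 2).
  by apply: iid_mean_ge0 => z; rewrite sqr_ge0.
have -> : iid_mean w (fun z => (F z - m) ^+ 2) =
          iid_mean w (fun z => F z ^+ 2 + (- (2 * m) * F z + m ^+ 2)).
  by apply: eq_iid_mean => z; ring.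
rewrite !iid_meanD iid_meanZ iid_mean_cst -/m.
by rewrite (_ : - (2 * m) * m + m ^+ 2 = - m ^+ 2) ?subr_ge0//; ring.
Qed.

End Probability.

End ProductMean.

(** * Random subsets: a lower tail and a moment bound *)

Section RandomSubset.
Variables (R : realType) (E : finType).
Implicit Types (A B U : {set E}) (z : {ffun E -> bool}).

Definition bern (q : R) (b : bool) : R := if b then q else 1 - q.

Definition covers z A : bool := [forall e in A, z e].

(** Boolean configurations are read as subsets of [E]; this is the union with [A]. *)
Definition raise A z : {ffun E -> bool} := [ffun e => (e \in A) || z e].

Lemma bern_ge0 (q : R) b : 0 <= q <= 1 -> 0 <= bern q b.
Proof. by case/andP=> q0 q1; case: b => //=; rewrite subr_ge0. Qed.

Lemma bern_sum1 (q : R) : \sum_b bern q b = 1.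
Proof. by rewrite big_bool/= addrC subrK. Qed.

Lemma covers_sub z A B : A \subset B -> covers z B -> covers z A.
Proof. by move=> AB /forall_inP zB; apply/forall_inP => e /(subsetP AB)/zB. Qed.

Lemma coversU z A B : covers z (A :|: B) = covers z A && covers z B.
Proof.
apply/idP/andP => [zAB|[/forall_inP zA /forall_inP zB]].
  by split; [exact: (covers_sub (finset.subsetUl A B) zAB)
            |exact: (covers_sub (finset.subsetUr A B) zAB)].
by apply/forall_inP => e; rewrite in_setU => /orP[/zA|/zB].
Qed.

Lemma covers_prod z A : (covers z A)%:R = \prod_e ((e \in A) ==> z e)%:R :> R.
Proof.
have [/forallP zA|] := boolP (covers z A).
  by rewrite big1// => e _; rewrite zA.
rewrite negb_forall => /existsP[e /negbTE ez].
by rewrite (bigD1 e)//= ez mul0r.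
Qed.

Section Bernoulli.
Variable q : R.
Hypothesis q01 : 0 <= q <= 1.
Let w_ge0 b : 0 <= bern q b := bern_ge0 b q01.
Let w_sum1 := bern_sum1 q.

Local Notation mean := (iid_mean (bern q)).

Lemma mean_covers A : mean (fun z => (covers z A)%:R) = q ^+ #|A|.
Proof.
under eq_iid_mean do rewrite covers_prod.
rewrite (iid_mean_prod _ (fun e b => ((e \in A) ==> b)%:R)).
rewrite (bigID (mem A))/= [X in _ * X]big1 ?mulr1 => [|e /negbTE ->]; last first.
  by rewrite big_bool/= !mulr1 addrC subrK.
rewrite (eq_bigr (fun=> q)) ?prodr_const// => e ->.
by rewrite big_bool/= mulr1 mulr0 addr0.
Qed.

(** Revealing that all of [A] is present multiplies by [q ^+ #|A|] and leaves
    the coordinates off [A] with their law; those of [A] are resampled from an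
    independent copy. *)
Lemma mean_coversM A (g : {ffun E -> bool} -> R) :
  mean (fun z => (covers z A)%:R * g z) =
  q ^+ #|A| * mean (fun z => g (raise A z)).
Proof.
rewrite -mean_covers -iid_meanZ.
under [RHS]eq_iid_mean do rewrite -iid_meanZr.
rewrite (iid_mean_pair (bern q) (bern q) (fun z z' => (covers z' A)%:R * g (raise A z))).
pose k e (v : bool * bool) := if e \in A then v.2 else v.1.
rewrite -(iid_mean_map (w := prodw (bern q) (bern q)) (g := k)); last first.
  move=> e u; rewrite (eq_bigl (fun v => k e v == u))// /k.
  rewrite -(pair_big_dep predT (fun a b => (if e \in A then b else a) == u)
       (fun a b => bern q a * bern q b))/=.
  by rewrite big_bool !(big_mkcond (fun _ : bool => _ == _)) !big_bool/=;
     case: (e \in A); case: u => /=; rewrite ?addr0 ?add0r/= /bern; ring.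
apply: eq_iid_mean => z; have -> : covers [ffun e => k e (z e)] A =
    covers [ffun e => (z e).2] A.
  by apply: eq_forallb => e; rewrite !ffunE /k; case: (e \in A).
have [zA|] := boolP (covers _ _); last by rewrite !mul0r.
congr (_ * g _); apply/ffunP => e; rewrite !ffunE /k.
by have /forallP/(_ e) := zA; rewrite ffunE; case: (e \in A).
Qed.

(** Positive correlation: an increasing event and a decreasing function. *)
Lemma mean_coversM_decr A (g : {ffun E -> bool} -> R) :
  (forall z, g (raise A z) <= g z) ->
  mean (fun z => (covers z A)%:R * g z) <= q ^+ #|A| * mean g.
Proof.
move=> gA; rewrite mean_coversM ler_wpM2l ?exprn_ge0//; first by case/andP: q01.
exact: le_iid_mean.
Qed.

Lemma prod_oneB_ge (I : Type) (s : seq I) (a : I -> R) :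
  (forall i, 0 <= a i <= 1) -> 1 - \sum_(i <- s) a i <= \prod_(i <- s) (1 - a i).
Proof.
move=> a01; elim: s => [|i s IH]; first by rewrite !big_nil subr0.
rewrite !big_cons; have /andP[ai0 ai1] := a01 i.
have S0 : 0 <= \sum_(j <- s) a j by rewrite sumr_ge0// => j _; case/andP: (a01 j).
apply: (@le_trans _ _ ((1 - a i) * (1 - \sum_(j <- s) a j))); last first.
  by rewrite ler_wpM2l// subr_ge0.
have := mulr_ge0 ai0 S0; nra.
Qed.

Section LowerTail.
Variables (T : finType) (A : T -> {set E}) (c : R).
Hypothesis c01 : 0 <= c <= 1.

Let fac t z : R := 1 - c * (covers z (A t))%:R.

Let fac01 t z : 0 <= fac t z <= 1.
Proof.
rewrite /fac; case/andP: c01 => c0 c1; case: (covers z _); rewrite ?mulr1 ?mulr0; lra.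
Qed.

Let prod_fac01 (s : seq T) (P : pred T) z : 0 <= \prod_(t <- s | P t) fac t z <= 1.
Proof.
apply/andP; split; first by rewrite prodr_ge0// => t _; case/andP: (fac01 t z).
by apply: prodr_ile1 => t _; exact: fac01.
Qed.

(** The members near [k], those meeting [A k], are the only ones whose factors
    feel the presence of [A k].  The product [g] of the other factors is
    independent of it, and each near member is negatively correlated with
    [g].  When the bracket is negative, the trivial bound suffices. *)
Lemma prod_fac_step (k : T) (s : seq T) : uniq s ->
  mean (fun z => \prod_(t <- k :: s) fac t z) <=
  (1 - c * q ^+ #|A k| + c ^+ 2 * \sum_(t | A t :&: A k != set0) q ^+ #|A t :|: A k|)
  * mean (fun z => \prod_(t <- s) fac t z).
Proof.
move=> us; case/andP: (c01) => c0 c1; have q0 : 0 <= q by case/andP: q01.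
under eq_iid_mean do rewrite big_cons {1}/fac mulrBl mul1r -mulrA.
rewrite iid_meanB iid_meanZ.
set M := mean (fun z => \prod_(t <- s) fac t z).
pose near t := A t :&: A k != set0.
pose g z := \prod_(t <- s | ~~ near t) fac t z.
set S := \sum_(t | _) _.
have M0 : 0 <= M by apply: iid_mean_ge0 => // z; case/andP: (prod_fac01 s predT z).
have Mg : M <= mean g.
  apply: le_iid_mean => // z; rewrite /g [leLHS](bigID near)/=.
  have /andP[h1 h2] := prod_fac01 s near z.
  have /andP[h3 h4] := prod_fac01 s (predC near) z.
  by rewrite -[leRHS]mul1r ler_wpM2r.
suff h : (q ^+ #|A k| - c * S) * M <=
    mean (fun z => (covers z (A k))%:R * \prod_(t <- s) fac t z).
  by have := ler_wpM2l c0 h; nra.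
have g_decr B z : g (raise B z) <= g z.
  apply: ler_prod => t _; have /andP[-> _] := fac01 t (raise B z).
  rewrite /fac lerB//= ler_wpM2l// ler_nat.
  case: (boolP (covers z _)) => // /forall_inP zt; rewrite lt0b.
  by apply/forall_inP => e /zt ze; rewrite ffunE ze orbT.
have gk z : g (raise (A k) z) = g z.
  apply: eq_bigr => t; rewrite negbK /fac => /eqP tk; congr (1 - c * (nat_of_bool _)%:R).
  apply: eq_forallb => e; rewrite !ffunE; case: (boolP (e \in A t)) => //= et.
  suff /negbTE -> : e \notin A k by [].
  by apply: contraPN tk => ek /setP/(_ e); rewrite !inE et ek.
have [neg|pos] := ltP (q ^+ #|A k| - c * S) 0.
  apply: (@le_trans _ _ 0); first by rewrite nmulr_rle0.
  by apply: iid_mean_ge0 => // z; rewrite mulr_ge0//; case/andP: (prod_fac01 s predT z).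
apply: (le_trans (ler_wpM2l pos Mg)).
have -> : (q ^+ #|A k| - c * S) * mean g =
   q ^+ #|A k| * mean (fun z => g (raise (A k) z)) -
   \sum_(t | near t) c * (q ^+ #|A t :|: A k| * mean g).
  rewrite mulrBl; congr (_ - _); first by congr (_ * _); apply: eq_iid_mean => z; rewrite gk.
  by rewrite /S -mulrA mulr_suml mulr_sumr.
rewrite -mean_coversM.
apply: (@le_trans _ _ (mean (fun z => (covers z (A k))%:R * g z) -
    \sum_(t | near t) c * mean (fun z => (covers z (A t :|: A k))%:R * g z))).
  rewrite lerB//; apply: ler_sum => t _; rewrite ler_wpM2l//.
  exact: mean_coversM_decr.
under eq_bigr do rewrite -iid_meanZ.
rewrite -iid_mean_sum -iid_meanB; apply: le_iid_mean => // z.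
rewrite [in leRHS](bigID near)/= -/(g z).
have [zk|] := boolP (covers z (A k)); last first.
  rewrite !mul0r => nk; rewrite sub0r oppr_le0 sumr_ge0// => t _.
  rewrite mulr_ge0// mulr_ge0//; by case/andP: (prod_fac01 s (predC near) z).
rewrite !mul1r.
have -> : \sum_(t | near t) c * ((covers z (A t :|: A k))%:R * g z) =
    (\sum_(t | near t) c * (covers z (A t))%:R) * g z.
  by rewrite mulr_suml; apply: eq_bigr => t _; rewrite coversU zk andbT mulrA.
rewrite -{1}[g z]mul1r -mulrBl ler_wpM2r//.
  by case/andP: (prod_fac01 s (predC near) z).
have a01 t : 0 <= c * (covers z (A t))%:R <= 1.
  by have := fac01 t z; rewrite /fac; lra.
rewrite -[leRHS]big_filter.
apply: le_trans (prod_oneB_ge [seq t <- s | near t] a01).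
rewrite lerB// big_filter big_mkcond big_uniq//= [leLHS]big_mkcond [leRHS]big_mkcond/=.
apply: ler_sum => t _; case: (near t); case: ifP => // _.
by case/andP: (a01 t).
Qed.

(** The lower-tail estimate of Janson's inequality.  Multiplying the factors
    [1 - c I_t] in one at a time, each new factor gains [1 - c E I_t] up to the
    correlation with the members that meet it, because the remaining factors
    are decreasing in the random set. *)
Lemma mean_prod_fac :
  mean (fun z => \prod_t fac t z) <=
  expR (- (c * \sum_t q ^+ #|A t|) +
        c ^+ 2 * \sum_t \sum_(u | A u :&: A t != set0) q ^+ #|A u :|: A t|).
Proof.
case/andP: (c01) => c0 c1; have q0 : 0 <= q by case/andP: q01.
have h : forall s : seq T, uniq s -> mean (fun z => \prod_(t <- s) fac t z) <=
   \prod_(t <- s) expR (- (c * q ^+ #|A t|) +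
        c ^+ 2 * \sum_(u | A u :&: A t != set0) q ^+ #|A u :|: A t|).
  elim=> [_|k s IH /= /andP[_ us]].
    by under eq_iid_mean do rewrite big_nil; rewrite iid_mean_cst// big_nil.
  apply: (le_trans (prod_fac_step k us)); rewrite [leRHS]big_cons.
  have M0 : 0 <= mean (fun z => \prod_(t <- s) fac t z).
    by apply: iid_mean_ge0 => // z; case/andP: (prod_fac01 s predT z).
  apply: (@le_trans _ _ (expR (- (c * q ^+ #|A k|) +
        c ^+ 2 * \sum_(u | A u :&: A k != set0) q ^+ #|A u :|: A k|)
      * mean (fun z => \prod_(t <- s) fac t z))).
    by rewrite ler_wpM2r// -addrA expR_ge1Dx.
  by rewrite ler_wpM2l ?expR_ge0// IH.
apply: (le_trans (h _ (index_enum_uniq T))).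
by rewrite -expR_sum big_split/= sumrN -!mulr_sumr.
Qed.

End LowerTail.

(** The Chernoff form of the lower tail; [c] is the parameter of the
    exponential moment.  Since [1 - c >= expR (- 3/2 c)], the product is at least
    [expR (- 3/4 c mu)] on the event, which leaves a quarter of [c mu]. *)
Lemma lower_tail (T : finType) (A : T -> {set E}) (c mu : R) :
  0 <= c <= 1/4 -> mu = \sum_t q ^+ #|A t| ->
  mean (fun z => ((\sum_t (covers z (A t))%:R <= mu / 2)%R)%:R) <=
  expR (- (c * mu / 4) +
        c ^+ 2 * \sum_t \sum_(u | A u :&: A t != set0) q ^+ #|A u :|: A t|).
Proof.
move=> /andP[c0 c1] mudef; set De := \sum_t \sum_(u | _) _.
have c01 : 0 <= c <= 1 by apply/andP; split=> //; lra.
have step z : ((\sum_t (covers z (A t))%:R <= mu / 2)%R)%:R <=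
    expR (3/4 * c * mu) * \prod_t (1 - c * (covers z (A t))%:R).
  case: (leP (\sum_t _) _) => [Sle|_]; last first.
    rewrite mulr_ge0 ?expR_ge0// prodr_ge0// => t _.
    by case: (covers z _); rewrite ?mulr1 ?mulr0; lra.
  apply: (@le_trans _ _ (expR (3/4 * c * mu) * \prod_t expR (- (3/2 * c * (covers z (A t))%:R)))).
    rewrite -expR_sum -expRD sumrN -mulr_sumr -[X in X <= _]expR0 ler_expR.
    have := ler_wpM2l c0 Sle; nra.
  rewrite ler_wpM2l ?expR_ge0//; apply: ler_prod => t _; rewrite expR_ge0/=.
  case: (covers z _); last by rewrite /= !mulr0 oppr0 expR0 addr0.
  rewrite /= !mulr1 expRN.
  have h := expR_ge1Dx (3/2 * c).
  have h0 : 0 < 1 + 3/2 * c by lra.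
  apply: (@le_trans _ _ ((1 + 3/2 * c)^-1)).
    by rewrite lef_pV2 ?posrE ?expR_gt0.
  by rewrite -div1r ler_pdivrMr//; nra.
apply: (le_trans (le_iid_mean w_ge0 step)); rewrite iid_meanZ.
apply: (le_trans (ler_wpM2l (expR_ge0 _) (mean_prod_fac A c01))).
by rewrite -expRD ler_expR -mudef -/De; lra.
Qed.

(** Moments of a sum of monomials, one factor at a time: once [U] is known to
    be present, a further member [A t] only pays for its part outside [U], so
    a bound that is uniform over small [U] can be iterated. *)
Lemma moment_bound (T : finType) (P : pred T) (A : T -> {set E}) (k m : nat) (B : R) :
  0 <= B ->
  (forall t, (#|A t| <= k)%N) ->
  (forall U : {set E}, (#|U| <= k * m)%N -> \sum_(t | P t) q ^+ #|A t :\: U| <= B) ->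
  mean (fun z => (\sum_(t | P t) (covers z (A t))%:R) ^+ m) <= B ^+ m.
Proof.
move=> B0 Ak hB; have q0 : 0 <= q by case/andP: q01.
suff h : forall j (U : {set E}), (#|U| + k * j <= k * m)%N ->
   mean (fun z => (covers z U)%:R * (\sum_(t | P t) (covers z (A t))%:R) ^+ j)
   <= q ^+ #|U| * B ^+ j.
  have := h m set0; rewrite cards0 add0n => /(_ (leqnn _)); rewrite mul1r.
  apply: le_trans; apply: le_iid_mean => // z.
  have -> : covers z set0 by apply/forall_inP => e; rewrite inE.
  by rewrite mul1r.
elim=> [|j IH] U Uj.
  under eq_iid_mean do rewrite expr0 mulr1.
  by rewrite mean_covers expr0 mulr1.
under eq_iid_mean => z do rewrite exprS mulr_suml mulr_sumr.
rewrite iid_mean_sum.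
apply: (@le_trans _ _ (\sum_(t | P t) q ^+ #|U :|: A t| * B ^+ j)).
  apply: ler_sum => t _.
  under eq_iid_mean => z do rewrite mulrA -natrM mulnb -coversU.
  apply: IH; have := cardsU U (A t); have := Ak t; lia.
rewrite -mulr_suml exprS mulrA ler_wpM2r ?exprn_ge0//.
have -> : \sum_(t | P t) q ^+ #|U :|: A t| = q ^+ #|U| * \sum_(t | P t) q ^+ #|A t :\: U|.
  rewrite mulr_sumr; apply: eq_bigr => t _; rewrite -exprD; congr (_ ^+ _).
  have := cardsU U (A t); have := cardsD (A t) U; rewrite setIC.
  by have := subset_leq_card (subsetIr U (A t)); lia.
by rewrite ler_wpM2l ?exprn_ge0// hB//; lia.
Qed.

End Bernoulli.
End RandomSubset.

(** * Transversals of the classes and their spines *)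

Lemma bin2_double n : ('C(n, 2) * 2 = n * (n - 1))%N.
Proof. by rewrite -[X in (_ * X)%N]/(2`!) bin_ffact ffactnS ffactn1 subn1. Qed.

Lemma pronic_diff (n i : nat) : (0 < i)%N -> (i <= n)%N ->
  (n * (n - 1) - i * (i - 1) = (n + i - 1) * (n - i))%N.
Proof.
case: i => // i _ /subnK <-; move: (n - i.+1)%N => k.
rewrite addnK !addnS !subn1/= [X in (X - _)%N](_ : _ = i.+1 * i + (k + i + i.+1) * k)%N.
  by rewrite addKn addnS.
by lia.
Qed.

Section Transversals.
Variables (R : realType) (r N : nat) (E : finType) (D0 : {set 'I_r}).
Variable edge : {set 'I_r} -> {ffun 'I_r -> 'I_N} -> E.
Implicit Types (D I : {set 'I_r}) (f g : {ffun 'I_r -> 'I_N}) (U : {set E}).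
Hypothesis r_ge3 : (3 <= r)%N.
Hypothesis card_D0 : #|D0| = 2%N.
(* A transversal [f] picks a position in each of the [r] classes, and [edge D f]
   is its edge between the two classes in [D]. *)
Hypothesis edge_inj : forall D (D' : {set 'I_r}) f g, #|D| = 2%N -> #|D'| = 2%N ->
  edge D f = edge D' g -> D = D' /\ {in D, f =1 g}.

Definition other_pairs : {set {set 'I_r}} := [set D : {set 'I_r} | (#|D| == 2%N) && (D != D0)].

Definition other_pairs_in I : nat := #|[set D in other_pairs | D \subset I]|.

(** The clique on [f] without its edge in the block [D0]. *)
Definition spine f : {set E} := [set edge D f | D in other_pairs].

Lemma classes_le I : (#|I| <= r)%N.
Proof. by rewrite -[leqRHS]card_ord; exact: max_card. Qed.

Lemma other_pairs_inE I : (other_pairs_in I + (D0 \subset I) = 'C(#|I|, 2))%N.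
Proof.
rewrite -(cards_draws I 2) (cardsD1 D0) addnC; congr (_ + _)%N.
  by rewrite inE card_D0 eqxx andbT.
apply: eq_card => D; rewrite !inE.
by case: (D \subset I); case: (#|D| == 2%N); case: (D != D0).
Qed.

Lemma card_other_pairs : #|other_pairs| = ('C(r, 2) - 1)%N.
Proof.
have := other_pairs_inE [set: 'I_r]; rewrite cardsT card_ord /other_pairs_in.
have -> : [set D in other_pairs | D \subset [set: 'I_r]] = other_pairs.
  by apply/setP => D; rewrite inE subsetT andbT.
by rewrite subsetT; lia.
Qed.

Lemma other_pairs_le I : (other_pairs_in I <= #|other_pairs|)%N.
Proof. by apply: subset_leq_card; apply/subsetP => D; rewrite inE => /andP[]. Qed.

Lemma card_other_pairs_gt0 : (0 < #|other_pairs|)%N.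
Proof.
rewrite card_other_pairs; have : ('C(3, 2) <= 'C(r, 2))%N by apply: leq_bin2l.
by rewrite (_ : 'C(3, 2) = 3%N) //; lia.
Qed.

Lemma other_pairsP D : D \in other_pairs -> #|D| = 2%N.
Proof. by rewrite inE => /andP[/eqP]. Qed.

Lemma card_spine f : #|spine f| = #|other_pairs|.
Proof.
apply: card_in_imset => D D' /other_pairsP D2 /other_pairsP D'2 h.
by case: (edge_inj D2 D'2 h).
Qed.

Lemma spineP f e : reflect (exists2 D, D \in other_pairs & e = edge D f) (e \in spine f).
Proof. exact: imsetP. Qed.

(** Edges of the spine that lie in [U] join classes of [I], so at least those
    not inside [I] remain to be paid for. *)
Lemma card_spineD g U I :
  (forall D, D \in other_pairs -> edge D g \in U -> D \subset I) ->
  (#|other_pairs| <= #|spine g :\: U| + other_pairs_in I)%N.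
Proof.
move=> h; rewrite -(card_spine g) -(cardsID U (spine g)) addnC leq_add2l.
apply: (@leq_trans #|[set edge D g | D in [set D in other_pairs | D \subset I]]|).
  apply: subset_leq_card; apply/subsetP => e; rewrite inE => /andP[/spineP[D Dp ->] eU].
  by apply: imset_f; rewrite inE Dp h.
exact: leq_imset_card.
Qed.

(** The positions in class [i] from which [U] can be reached. *)
Definition touched U (i : 'I_r) : {set 'I_N} :=
  [set a | [exists f : {ffun 'I_r -> 'I_N}, [exists D in other_pairs,
     [&& i \in D, f i == a & edge D f \in U]]]].

(** An edge determines its position in each class that it joins. *)
Lemma card_touched U i : (#|touched U i| <= #|U|)%N.
Proof.
pose cond (e : E) (a : 'I_N) := [exists f : {ffun 'I_r -> 'I_N}, [exists D in other_pairs,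
     [&& i \in D, f i == a & edge D f == e]]].
have [a0|] := pickP (mem (touched U i)); last first.
  by move=> h; rewrite (eq_card0 h).
move=> _; pose h (e : E) := odflt a0 [pick a | cond e a].
apply: (@leq_trans #|[set h e | e in U]|); last exact: leq_imset_card.
apply: subset_leq_card; apply/subsetP => a; rewrite /touched inE.
case/existsP=> f /exists_inP[D Dp /and3P[iD /eqP fa eU]].
apply/imsetP; exists (edge D f) => //; rewrite /h; case: pickP => [b|]; last first.
  move=> /(_ a) /= /negbT/negP[]; rewrite /cond; apply/existsP; exists f.
  by apply/exists_inP; exists D => //; rewrite iD fa !eqxx.
case/existsP=> g /exists_inP[D' D'p /and3P[iD' /eqP gb /eqP ee]] /=.
have [DD fg] := edge_inj (other_pairsP D'p) (other_pairsP Dp) ee.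
by rewrite -fa -gb fg.
Qed.

Lemma touched_edge U D g i : D \in other_pairs -> edge D g \in U -> i \in D ->
  g i \in touched U i.
Proof.
move=> Dp eU iD; rewrite /touched inE; apply/existsP; exists g; apply/exists_inP.
by exists D => //; rewrite iD eqxx eU.
Qed.

Definition hits (T : 'I_r -> {set 'I_N}) g : {set 'I_r} := [set i | g i \in T i].

Lemma in_hits (T : 'I_r -> {set 'I_N}) g i : (i \in hits T g) = (g i \in T i).
Proof. by rewrite inE. Qed.

Lemma card_hits (T : 'I_r -> {set 'I_N}) (L : nat) I : (forall i, (#|T i| <= L)%N) ->
  (#|[set g : {ffun 'I_r -> 'I_N} | hits T g == I]| <= L ^ #|I| * N ^ (r - #|I|))%N.
Proof.
move=> TL.
pose F i : {set 'I_N} := if i \in I then T i else [set: 'I_N].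
apply: (@leq_trans #|(family F : simpl_pred {ffun 'I_r -> 'I_N})|).
  apply: subset_leq_card; apply/subsetP => g; rewrite inE => /eqP gI.
  apply/familyP => i; rewrite /F; case: ifP => [|_]; last by rewrite inE.
  by rewrite -gI in_hits.
rewrite card_family foldrE big_map big_enum/= (bigID (mem I))/=.
have -> : (r - #|I| = #|[predC I]|)%N.
  by have := cardC I; rewrite card_ord; lia.
rewrite -!prod_nat_const; apply: leq_mul.
  by apply: leq_prod => i iI; rewrite /F iI.
apply: eq_leq; apply: eq_big => i; first by rewrite !inE.
by rewrite /F => /negbTE ->; rewrite cardsT card_ord.
Qed.

Section Weights.
Variables (q : R).
Hypothesis q01 : 0 <= q <= 1.
Let q0 : 0 <= q. Proof. by case/andP: q01. Qed.
Let q1 : q <= 1. Proof. by case/andP: q01. Qed.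

(** The mean number of spines through given positions in the classes [I] when
    the edges among these positions are present. *)
Definition pinned_mean I : R := N%:R ^+ (r - #|I|) * q ^+ (#|other_pairs| - other_pairs_in I).

(** Classifying the transversals [g] by the set of classes in which they meet
    prescribed positions, of which there are at most [L] per class. *)
Lemma sum_by_hits (T : 'I_r -> {set 'I_N}) (L : nat) (P : pred {ffun 'I_r -> 'I_N})
    (Q : pred {set 'I_r}) (d : {ffun 'I_r -> 'I_N} -> nat) (b : R) :
  (0 < L)%N -> (forall i, (#|T i| <= L)%N) ->
  (forall g, P g -> Q (hits T g)) ->
  (forall g, P g -> (#|other_pairs| <= d g + other_pairs_in (hits T g))%N) ->
  (forall I, Q I -> pinned_mean I <= b) -> 0 <= b ->
  \sum_(g | P g) q ^+ d g <= 2 ^+ r * L%:R ^+ r * b.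
Proof.
move=> L0 TL PQ Pd Qb b0.
rewrite (partition_big (hits T) Q)//=.
have -> : 2 ^+ r * L%:R ^+ r * b = \sum_(I : {set 'I_r}) L%:R ^+ r * b.
  rewrite sumr_const -mulrA -cardsT -powersetT card_powerset cardsT card_ord.
  by rewrite -natrX mulr_natl.
rewrite big_mkcond/=; apply: ler_sum => I _; case: ifP => [QI|_]; last first.
  by rewrite mulr_ge0// exprn_ge0.
apply: (@le_trans _ _
  (\sum_(g in [set g : {ffun 'I_r -> 'I_N} | hits T g == I]) q ^+ (#|other_pairs| - other_pairs_in I))).
  rewrite big_mkcond [leRHS]big_mkcond/=; apply: ler_sum => g _; rewrite inE.
  case: ifP => [/andP[Pg /eqP <-]|]; last by case: ifP => //; rewrite ?exprn_ge0.
  by rewrite eqxx ler_wiXn2l// leq_subLR addnC; exact: Pd.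
rewrite sumr_const -[leLHS]mulr_natl.
apply: (@le_trans _ _ ((L ^ #|I| * N ^ (r - #|I|))%:R * q ^+ (#|other_pairs| - other_pairs_in I))).
  by rewrite ler_wpM2r ?exprn_ge0// ler_nat card_hits.
rewrite natrM !natrX -mulrA; apply: ler_pM => //; rewrite ?exprn_ge0//.
- by rewrite mulr_ge0 ?exprn_ge0.
- rewrite ler_weXn2l ?ler1n//.
  exact: classes_le.
- exact: Qb.
Qed.

Variables (Y kappa mu : R).
Hypothesis Y_ge1 : 1 <= Y.
Hypothesis kappa01 : 0 <= kappa <= 1.
Hypothesis mu_def : mu = N%:R ^+ r * q ^+ #|other_pairs|.
Hypothesis sparse_subgraphs : Y ^+ 2 <= N%:R ^+ 2 * q ^+ (r - 2).
Hypothesis mu_ge : Y <= mu.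
Hypothesis few_extensions : N%:R ^+ 2 * q ^+ r.+1 <= kappa ^+ 2.

Let Y0 : 0 < Y. Proof. exact: lt_le_trans Y_ge1. Qed.
Let mu0 : 0 < mu. Proof. exact: lt_le_trans mu_ge. Qed.

Lemma pinned_mean_split I : pinned_mean I * (N%:R ^+ #|I| * q ^+ other_pairs_in I) = mu.
Proof.
rewrite /pinned_mean mu_def mulrACA -!exprD; congr (_ ^+ _ * _ ^+ _).
  by rewrite subnK ?classes_le.
  by rewrite subnK ?other_pairs_le.
Qed.

(** Equivalently, the part of a spine in the classes [I] has at least [Y] copies
    on average.  For [i < r] classes this number is at least
    [N ^ i q ^ 'C(i, 2) = (N q ^ ((i - 1) / 2)) ^ i], whose base decreases in [i];
    for all the classes it is [mu]. *)
Lemma pinned_mean_le_mu I : (0 < other_pairs_in I)%N -> pinned_mean I <= mu / Y.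
Proof.
move=> eI; rewrite ler_pdivlMr// -[leRHS](pinned_mean_split I).
rewrite ler_wpM2l ?mulr_ge0 ?exprn_ge0//.
have Ir := classes_le I.
have [Ieq|Ilt] : (#|I| = r)%N \/ (#|I| < r)%N.
  by move: Ir; rewrite leq_eqVlt => /orP[/eqP|]; [left|right].
  have -> : other_pairs_in I = #|other_pairs|.
    have -> : I = [set: 'I_r] by apply/eqP; rewrite eqEcard subsetT cardsT card_ord Ieq /=.
    by apply: eq_card => D; rewrite inE subsetT andbT.
  by rewrite Ieq -mu_def.
set i := #|I| in Ir Ilt *.
have eC := other_pairs_inE I; rewrite -/i in eC.
have i2 : (2 <= i)%N.
  case: (ltnP i 2) => // i1; move: (bin_small i1); rewrite -eC => /eqP.
  by rewrite addn_eq0 => /andP[/eqP h _]; rewrite h in eI.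
apply: (@le_trans _ _ (N%:R ^+ i * q ^+ 'C(i, 2))); last first.
  by rewrite ler_wpM2l ?exprn_ge0// ler_wiXn2l// -eC leq_addr.
rewrite -(@ler_pXn2r _ 2)// ?nnegrE ?mulr_ge0 ?exprn_ge0 ?(ltW Y0)//.
have -> : (N%:R ^+ i * q ^+ 'C(i, 2)) ^+ 2 = (N%:R ^+ 2 * q ^+ (i - 1)) ^+ i.
  by rewrite !exprMn -!exprM bin2_double -expr2 -exprM mulnC [((i - 1) * i)%N]mulnC.
apply: (@le_trans _ _ ((Y ^+ 2) ^+ i)).
  by apply: ler_eXnr; rewrite ?exprn_ege1//; exact: leq_trans i2.
apply: lerXn2r; rewrite ?nnegrE ?mulr_ge0 ?exprn_ge0// ?(ltW Y0)//.
apply: (le_trans sparse_subgraphs); rewrite ler_wpM2l ?exprn_ge0// ler_wiXn2l//.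
by clear -Ilt i2; lia.
Qed.

(** The classes outside [I] can be added to [I] in about
    [(N q ^ ((r + #|I| - 1) / 2)) ^ (r - #|I|)] ways, and the base is at most
    [N q ^ ((r + 1) / 2)] as [I] has at least two classes.  Squares avoid the
    half-integral exponents. *)
Lemma pinned_mean_le_kappa I : D0 \subset I -> pinned_mean I ^+ 2 <= (kappa ^+ 2) ^+ (r - #|I|).
Proof.
move=> DI; have Ir := classes_le I.
have eC := other_pairs_inE I; have cD := subset_leq_card DI; rewrite card_D0 in cD.
have c1 : ('C(#|I|, 2) * 2 = #|I| * (#|I| - 1))%N.
  exact: bin2_double.
have c2 : ('C(r, 2) * 2 = r * (r - 1))%N.
  exact: bin2_double.
rewrite DI in eC.
have -> : pinned_mean I ^+ 2 = (N%:R ^+ 2 * q ^+ (r + #|I| - 1)) ^+ (r - #|I|).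
  rewrite /pinned_mean card_other_pairs !exprMn -!exprM -expr2 -exprM mulnC; congr (_ * _ ^+ _).
  have -> : ('C(r, 2) - 1 - other_pairs_in I = 'C(r, 2) - 'C(#|I|, 2))%N.
    by rewrite -eC -subnDA addnC.
  clear eC; by rewrite mulnBl c1 c2 pronic_diff// (leq_trans _ cD).
have k0 : 0 <= kappa by case/andP: kappa01.
apply: lerXn2r; rewrite ?nnegrE ?mulr_ge0 ?exprn_ge0//.
apply: (le_trans _ few_extensions); rewrite ler_wpM2l ?exprn_ge0// ler_wiXn2l//.
by clear -cD; lia.
Qed.

Lemma pinned_mean_le1 I : D0 \subset I -> pinned_mean I <= 1.
Proof.
move=> DI; case/andP: kappa01 => k0 k1.
rewrite -(@ler_pXn2r _ 2)// ?nnegrE ?mulr_ge0 ?exprn_ge0// expr1n.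
by apply: (le_trans (pinned_mean_le_kappa DI)); rewrite -exprM exprn_ile1.
Qed.

Lemma pinned_mean_le_kappa_proper I : D0 \subset I -> I != [set: 'I_r] -> pinned_mean I <= kappa.
Proof.
move=> DI IT; case/andP: kappa01 => k0 k1.
rewrite -(@ler_pXn2r _ 2)// ?nnegrE ?mulr_ge0 ?exprn_ge0//.
apply: (le_trans (pinned_mean_le_kappa DI)); rewrite -[leRHS]expr1 ler_wiXn2l ?exprn_ge0//.
  by rewrite exprn_ile1.
rewrite subn_gt0 ltnNge; apply: contra IT => h.
by rewrite eqEcard subsetT cardsT card_ord.
Qed.

(** A spine that uses an edge of a small set [U] contains a part with an edge
    among the positions touched by [U], and such a part loses a factor [Y]. *)
Lemma sum_spine_meeting U (L : nat) : (0 < L)%N -> (#|U| <= L)%N ->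
  \sum_(f | spine f :&: U != set0) q ^+ #|spine f :\: U| <=
  2 ^+ r * L%:R ^+ r * (mu / Y).
Proof.
move=> L0 UL.
apply: (@sum_by_hits (touched U) _ _ (fun I => 0 < other_pairs_in I)%N) => //.
- by move=> i; exact: leq_trans (card_touched U i) UL.
- move=> f /set0Pn[e]; rewrite inE => /andP[/spineP[D Dp ->] eU].
  apply/card_gt0P; exists D; rewrite inE Dp; apply/subsetP => i iD.
  by rewrite in_hits (touched_edge Dp).
- move=> f _; apply: card_spineD => D Dp eU; apply/subsetP => i iD.
  by rewrite in_hits (touched_edge Dp).
- exact: pinned_mean_le_mu.
- by rewrite divr_ge0// ltW.
Qed.

Lemma edge_agree f g : edge D0 g = edge D0 f -> {in D0, g =1 f}.
Proof. by move=> h; case: (edge_inj card_D0 card_D0 h). Qed.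

(** Completions of the edge of [f] in [D0], whatever small set [U] of edges is
    known to be present: all the weights are at most [1]. *)
Lemma sum_spine_extending f U (L : nat) : (0 < L)%N -> (#|U| <= L)%N ->
  \sum_(g | edge D0 f == edge D0 g) q ^+ #|spine g :\: U| <= 2 ^+ r * L%:R ^+ r.
Proof.
move=> L0 UL; rewrite -[leRHS]mulr1.
pose T i := if i \in D0 then [set f i] else touched U i.
apply: (@sum_by_hits T _ _ (fun I => D0 \subset I)) => //.
- move=> i; rewrite /T; case: ifP => _; first by rewrite cards1.
  exact: leq_trans (card_touched U i) UL.
- move=> g /eqP/esym/edge_agree h; apply/subsetP => i iD.
  by rewrite in_hits /T iD h// set11.
- move=> g /eqP/esym/edge_agree h; apply: card_spineD => D Dp eU; apply/subsetP => i iD.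
  rewrite in_hits /T; case: ifP => [iD0|_]; first by rewrite h// set11.
  by rewrite (touched_edge Dp).
- exact: pinned_mean_le1.
Qed.

(** Other completions of the same edge.  A spine [g] that agrees with [f] exactly
    on the classes [I] costs [pinned_mean I], and [I] is proper as [g] is not [f]. *)
Lemma sum_spine_twin f :
  \sum_(g | (f != g) && (edge D0 f == edge D0 g)) q ^+ #|spine g :\: spine f| <=
  2 ^+ r * kappa.
Proof.
rewrite -[2 ^+ r]mulr1 -[X in _ * X * _](expr1n _ r).
apply: (@sum_by_hits (fun i => [set f i]) 1 _
         (fun I => (D0 \subset I) && (I != [set: 'I_r]))) => //.
- by move=> i; rewrite cards1.
- move=> g /andP[fg /eqP/esym/edge_agree h]; apply/andP; split.
    by apply/subsetP => i iD; rewrite inE h// set11.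
  apply: contra fg => /eqP/setP fg; apply/eqP/ffunP => i.
  by have := fg i; rewrite in_hits !inE => /eqP.
- move=> g _; apply: card_spineD => D Dp /spineP[D' D'p e]; apply/subsetP => i iD.
  have [_ h] := edge_inj (other_pairsP Dp) (other_pairsP D'p) e.
  by rewrite in_hits h// set11.
- by move=> I /andP[]; exact: pinned_mean_le_kappa_proper.
- by case/andP: kappa01.
Qed.

End Weights.
End Transversals.

(** * Concentration of the number of spines *)

Lemma cardsU_diff (T : finType) (A B : {set T}) :
  #|A :|: B| = (#|B| + #|A :\: B|)%N.
Proof. by rewrite cardsU cardsD [in LHS]addnC addnBA ?subset_leq_card ?subsetIl. Qed.

Section SpineTails.
Variables (R : realType) (r N : nat) (E : finType) (D0 : {set 'I_r}).
Variable edge : {set 'I_r} -> {ffun 'I_r -> 'I_N} -> E.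
Implicit Types (D I : {set 'I_r}) (f g : {ffun 'I_r -> 'I_N}) (U : {set E}).
Hypothesis r_ge3 : (3 <= r)%N.
Hypothesis card_D0 : #|D0| = 2%N.
Hypothesis edge_inj : forall D (D' : {set 'I_r}) f g, #|D| = 2%N -> #|D'| = 2%N ->
  edge D f = edge D' g -> D = D' /\ {in D, f =1 g}.
Variables (q Y kappa mu a : R) (m L : nat).
Hypothesis q01 : 0 <= q <= 1.
Hypothesis kappa01 : 0 <= kappa <= 1.
Hypothesis mu_def : mu = N%:R ^+ r * q ^+ #|other_pairs D0|.
Hypothesis sparse_subgraphs : Y ^+ 2 <= N%:R ^+ 2 * q ^+ (r - 2).
Hypothesis mu_ge : Y <= mu.
Hypothesis few_extensions : N%:R ^+ 2 * q ^+ r.+1 <= kappa ^+ 2.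
Hypothesis m_gt0 : (0 < m)%N.
Hypothesis L_ge : (3 * #|other_pairs D0| * m <= L)%N.
Hypothesis a_def : a = 2 ^+ r * L%:R ^+ r.
Hypothesis Y_large : 32 * a ^+ 2 <= Y.
Hypothesis kappa_small : 2 ^+ r * kappa <= 1/16.

Local Notation mean := (iid_mean (bern q)).
Local Notation spine := (spine D0 edge).
Local Notation other_pairs := (other_pairs D0).

Definition twins (fg : {ffun 'I_r -> 'I_N} * {ffun 'I_r -> 'I_N}) : bool :=
  (fg.1 != fg.2) && (edge D0 fg.1 == edge D0 fg.2).

Definition spine_count (z : {ffun E -> bool}) : R := \sum_f (covers z (spine f))%:R.

Definition twin_count (z : {ffun E -> bool}) : R :=
  \sum_(fg | twins fg) (covers z (spine fg.1 :|: spine fg.2))%:R.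

Let q0 : 0 <= q. Proof. by case/andP: q01. Qed.

Let L_gt0 : (0 < L)%N.
Proof. by apply: leq_trans L_ge; rewrite !muln_gt0 m_gt0 (card_other_pairs_gt0 r_ge3). Qed.

Let a_ge : 2 * m%:R <= a.
Proof.
rewrite a_def -exprMn -!natrM -natrX ler_nat.
have h1 : (m <= L)%N.
  by apply: leq_trans L_ge; rewrite leq_pmull// muln_gt0 (card_other_pairs_gt0 r_ge3).
apply: (@leq_trans (2 * L)%N); first by rewrite leq_mul2l.
by rewrite -[X in (X <= _)%N]expn1 leq_pexp2l ?muln_gt0// (ltnW (ltnW r_ge3)).
Qed.

Let a_ge1 : 1 <= a.
Proof. by apply: le_trans a_ge; rewrite -natrM ler1n muln_gt0 m_gt0. Qed.

Let Y_ge1 : 1 <= Y.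
Proof.
apply: le_trans Y_large; have := exprn_ege1 2 a_ge1; lra.
Qed.

Let mu_gt0 : 0 < mu. Proof. by apply: lt_le_trans mu_ge; apply: lt_le_trans Y_ge1. Qed.

Lemma sum_spine : \sum_f q ^+ #|spine f| = mu.
Proof.
rewrite (eq_bigr (fun=> q ^+ #|other_pairs|)) => [|f _]; last by rewrite (card_spine D0 edge_inj).
by rewrite sumr_const card_ffun !card_ord mu_def -[LHS]mulr_natl natrX.
Qed.

Lemma sum_spine_overlap :
  \sum_f \sum_(g | spine g :&: spine f != set0) q ^+ #|spine g :|: spine f| <=
  mu * (a * (mu / Y)).
Proof.
rewrite -{1}sum_spine mulr_suml; apply: ler_sum => f _.
have fL : (#|spine f| <= L)%N.
  rewrite (card_spine D0 edge_inj); apply: leq_trans L_ge.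
  by apply: (@leq_trans (3 * #|other_pairs|)%N); [exact: leq_pmull|exact: leq_pmulr].
have h := sum_spine_meeting r_ge3 card_D0 edge_inj q01 Y_ge1 mu_def
  sparse_subgraphs mu_ge L_gt0 fL; rewrite -a_def in h.
apply: le_trans (ler_wpM2l (exprn_ge0 #|spine f| q0) h).
rewrite mulr_sumr; apply: ler_sum => g _; rewrite -exprD.
by rewrite cardsU_diff.
Qed.

(** Two spines share an edge with probability at most [a / Y] relative to
    independence, so the variance term of the lower tail is negligible. *)
Lemma spine_count_lower :
  mean (fun z => ((spine_count z <= mu / 2)%R)%:R) <= expR (- m%:R).
Proof.
have a0 : 0 < a := lt_le_trans ltr01 a_ge1.
have Y0 : 0 < Y := lt_le_trans ltr01 Y_ge1.
(* This [c] makes the variance term half of [c mu / 4]. *)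
pose c := Y / (8 * a * mu).
have amu0 : 0 < 8 * a * mu by rewrite !mulr_gt0.
have c0 : 0 <= c by rewrite divr_ge0 ?ltW.
have c4 : c <= 1/4.
  rewrite /c ler_pdivrMr//.
  have : mu <= a * mu by rewrite ler_peMl// ltW.
  by have := mu_ge; have := mu_gt0; lra.
have c04 : 0 <= c <= 1/4 by rewrite c0 c4.
have := lower_tail q01 c04 (esym sum_spine).
move=> /le_trans; apply; rewrite ler_expR.
apply: (@le_trans _ _ (- (c * mu / 4) + c ^+ 2 * (mu * (a * (mu / Y))))).
  by rewrite lerD2l ler_wpM2l ?exprn_ge0// sum_spine_overlap.
have -> : - (c * mu / 4) + c ^+ 2 * (mu * (a * (mu / Y))) = - (Y / (64 * a)).
  by rewrite /c; field; rewrite !gt_eqF.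
rewrite lerN2 ler_pdivlMr ?mulr_gt0//.
apply: le_trans Y_large; rewrite expr2.
have := ler_wpM2l (ltW a0) a_ge; lra.
Qed.

Let cardUD f g U : #|(spine f :|: spine g) :\: U| =
  (#|spine f :\: U| + #|spine g :\: (spine f :|: U)|)%N.
Proof.
have -> : (spine f :|: spine g) :\: U =
    (spine f :\: U) :|: (spine g :\: (spine f :|: U)).
  by apply/setP => e; rewrite !inE; case: (e \in U); case: (e \in spine f); case: (e \in spine g).
rewrite cardsU (_ : _ :&: _ = set0) ?cards0 ?subn0//.
by apply/setP => e; rewrite !inE; case: (e \in U); case: (e \in spine f); rewrite ?andbF.
Qed.

Let sum_twin_meeting U : (#|U| <= 2 * #|other_pairs| * m)%N ->
  \sum_(f | spine f :&: U != set0) \sum_(g | edge D0 f == edge D0 g)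
     q ^+ #|(spine f :|: spine g) :\: U| <= a * (mu / Y) * a.
Proof.
move=> UL.
have UL1 : (#|U| <= L)%N by apply: (leq_trans UL); apply: leq_trans L_ge; rewrite !leq_mul.
have h := sum_spine_meeting r_ge3 card_D0 edge_inj q01 Y_ge1 mu_def
  sparse_subgraphs mu_ge L_gt0 UL1; rewrite -a_def in h.
apply: le_trans (ler_wpM2r (le_trans ler01 a_ge1) h).
rewrite mulr_suml; apply: ler_sum => f _.
have UL2 : (#|spine f :|: U| <= L)%N.
  apply: leq_trans L_ge; rewrite cardsU (card_spine D0 edge_inj).
  apply: leq_trans (leq_subr _ _) _; rewrite (mulnDl 1 2) mulnDl mul1n leq_add//.
  exact: leq_pmulr.
have h' := sum_spine_extending r_ge3 card_D0 edge_inj q01 kappa01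
  few_extensions f L_gt0 UL2; rewrite -a_def in h'.
apply: le_trans (ler_wpM2l (exprn_ge0 #|spine f :\: U| q0) h').
by rewrite mulr_sumr; apply: ler_sum => g _; rewrite -exprD cardUD.
Qed.

(** A pair of twins that avoids [U] is counted as in [sum_spine_twin]; if one of
    them meets [U], the factor [1 / Y] from it absorbs the bounded number of
    completions for the other. *)
Lemma sum_twins U : (#|U| <= 2 * #|other_pairs| * m)%N ->
  \sum_(fg | twins fg) q ^+ #|(spine fg.1 :|: spine fg.2) :\: U| <= mu / 8.
Proof.
move=> UL.
pose X f g := q ^+ #|(spine f :|: spine g) :\: U|.
have X0 f g : 0 <= X f g by rewrite exprn_ge0.
pose Z f g := if twins (f, g) then q ^+ #|spine f| * q ^+ #|spine g :\: spine f| else 0.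
pose M f g := if (spine f :&: U != set0) && (edge D0 f == edge D0 g) then X f g else 0.
have M0 f g : 0 <= M f g by rewrite /M; case: ifP.
have -> : \sum_(fg | twins fg) q ^+ #|(spine fg.1 :|: spine fg.2) :\: U| =
    \sum_f \sum_g (if twins (f, g) then X f g else 0).
  by rewrite pair_big/= big_mkcond/=; apply: eq_bigr => -[f g].
have sumM : \sum_f \sum_g M f g <= a * (mu / Y) * a.
  apply: le_trans (sum_twin_meeting UL); rewrite [leRHS]big_mkcond/=.
  apply: ler_sum => f _; rewrite /M; case: ifP => _; last by rewrite /= big1.
  by rewrite /= -big_mkcond.
have sumZ : \sum_f \sum_g Z f g <= mu * (2 ^+ r * kappa).
  rewrite -sum_spine mulr_suml; apply: ler_sum => f _.
  have h := sum_spine_twin r_ge3 card_D0 edge_inj q01 kappa01 few_extensions f.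
  apply: le_trans (ler_wpM2l (exprn_ge0 #|spine f| q0) h).
  by rewrite /Z mulr_sumr -big_mkcond/=.
apply: (@le_trans _ _ (\sum_f \sum_g (Z f g + (M f g + M g f)))).
  apply: ler_sum => f _; apply: ler_sum => g _; rewrite /Z.
  case: (boolP (twins (f, g))) => [/andP[/= fg e]|_]; last by rewrite add0r addr_ge0.
  have [fU|fU] := boolP (spine f :&: U != set0).
    have -> : M f g = X f g by rewrite /M fU e.
    by rewrite addrCA lerDl addr_ge0// mulr_ge0 ?exprn_ge0.
  have [gU|gU] := boolP (spine g :&: U != set0).
    have -> : M g f = X f g by rewrite /M gU eq_sym e/= /X setUC.
    by rewrite addrA lerDr addr_ge0// mulr_ge0 ?exprn_ge0.
  rewrite -[leLHS]addr0 lerD ?addr_ge0//.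
  rewrite -exprD /X; rewrite !negbK in fU gU.
  have -> : (spine f :|: spine g) :\: U = spine f :|: spine g.
    apply/setP => e'; rewrite !inE.
    have /eqP/setP/(_ e') := fU; have /eqP/setP/(_ e') := gU; rewrite !inE.
    by case: (e' \in U); case: (e' \in spine f); case: (e' \in spine g).
  by rewrite setUC cardsU_diff.
under eq_bigr do rewrite !big_split/=.
rewrite !big_split/= [X in _ + (_ + X)]exchange_big/=.
apply: (le_trans (lerD sumZ (lerD sumM sumM))).
have a0 : 0 < a := lt_le_trans ltr01 a_ge1.
have Y0 : 0 < Y := lt_le_trans ltr01 Y_ge1.
have : a * (mu / Y) * a <= mu / 32.
  rewrite (_ : a * (mu / Y) * a = mu * (a ^+ 2 / Y)); last by field; rewrite gt_eqF.
  by rewrite ler_wpM2l ?(ltW mu_gt0)// ler_pdivrMr//; have := Y_large; lra.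
have : mu * (2 ^+ r * kappa) <= mu * (1 / 16) by rewrite ler_wpM2l ?(ltW mu_gt0).
lra.
Qed.

(** Markov's inequality for the [m]-th moment: the mean stays below [mu / 8], half
    the threshold, also when the edges of up to [m] pairs are present. *)
Lemma twin_count_upper :
  mean (fun z => ((mu / 4 <= twin_count z)%R)%:R) <= 2^-1 ^+ m.
Proof.
have mu4 : 0 < mu / 4 by have := mu_gt0; lra.
have tc0 z : 0 <= twin_count z by rewrite sumr_ge0.
apply: (@le_trans _ _ (mean (fun z => (mu / 4) ^- m * twin_count z ^+ m))).
  apply: le_iid_mean => [b|z]; first exact: bern_ge0.
  case: (leP (mu / 4) (twin_count z)) => [h|_]; last first.
    by rewrite mulr_ge0 ?invr_ge0 ?exprn_ge0 ?(ltW mu4).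
  rewrite -exprVn -exprMn exprn_ege1// mulrC ler_pdivlMr// mul1r//.
rewrite iid_meanZ.
have B0 : 0 <= mu / 8 by have := mu_gt0; lra.
have h := @moment_bound R E q q01 _ twins (fun fg => spine fg.1 :|: spine fg.2)
  (2 * #|other_pairs|)%N m (mu / 8) B0.
apply: (le_trans (ler_wpM2l _ (h _ _))).
- by rewrite invr_ge0 exprn_ge0// ltW.
- move=> fg; rewrite cardsU !(card_spine D0 edge_inj) mul2n -addnn.
  exact: leq_subr.
- by move=> U UL; apply: sum_twins.
- rewrite -exprVn -exprMn; apply: lerXn2r; rewrite ?nnegrE ?invr_ge0 ?ler0n//.
    by rewrite mulr_ge0 ?invr_ge0// ltW.
  by have := mu_gt0 => mu0; rewrite (_ : _ * _ = 2^-1)//; field; rewrite gt_eqF.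
Qed.

End SpineTails.

(** * Decoupling blocks of coordinates *)

Lemma big_pairE (G : nmodType) (V V' : finType) (F : V * V' -> G) :
  \sum_v F v = \sum_a \sum_b F (a, b).
Proof. by rewrite pair_bigA; apply: eq_bigr => -[]. Qed.

Section Decoupling.
Variables (R : realType) (E : finType) (p : R).
Hypothesis p01 : 0 <= p <= 1.
Implicit Types (z : {ffun E -> bool * bool}).

(** Each coordinate is doubled into two independent copies, the second for resampling. *)
Definition bern2 : bool * bool -> R := prodw (bern p) (bern p).

Lemma bern2_ge0 v : 0 <= bern2 v.
Proof. by rewrite mulr_ge0// bern_ge0. Qed.

Lemma bern2_sum1 : \sum_v bern2 v = 1.
Proof.
rewrite /bern2 /prodw -(pair_bigA _ (fun a b => bern p a * bern p b))/=.
by rewrite !big_bool/=; ring.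
Qed.

Local Notation mean := (iid_mean bern2).

Definition swap_copies (b : pred E) z : {ffun E -> bool * bool} :=
  [ffun e => if b e then ((z e).2, (z e).1) else z e].

Definition splice (b : pred E) z z' : {ffun E -> bool * bool} :=
  [ffun e => if b e then z' e else z e].

Lemma big_cond (V : finType) (P : pred V) (F : V -> R) :
  \sum_(v | P v) F v = \sum_v (P v)%:R * F v.
Proof. by rewrite big_mkcond/=; apply: eq_bigr => v _; case: (P v); rewrite ?mul1r ?mul0r. Qed.

Lemma mean_splice (b : pred E) (F : {ffun E -> bool * bool} -> R) :
  mean F = mean (fun z => mean (fun z' => F (splice b z z'))).
Proof.
rewrite (iid_mean_pair bern2 bern2 (fun z z' => F (splice b z z'))).
rewrite -(iid_mean_map (w := prodw bern2 bern2) (g := fun e v => if b e then v.2 else v.1)).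
  by apply: eq_iid_mean => u; congr F; apply/ffunP => e; rewrite !ffunE.
move=> e [u1 u2]; rewrite big_cond; do ![rewrite big_pairE/= | rewrite big_bool/=].
rewrite /bern2 /prodw /bern /=.
  by case: (b e); case: u1; case: u2; rewrite !xpair_eqE/=; ring.
Qed.

(** One decoupling step.  Conditionally on the coordinates off [b], the
    squared modulus of the mean of [exp (i F)] is the mean of
    [exp (i (F - F'))] over two independent values of the coordinates in [b];
    as [F] ignores the second copy of these, the two values can be stored in
    the two copies and exchanged by [swap_copies b]. *)
Lemma decoupling_step (b : pred E) (F : {ffun E -> bool * bool} -> R) :
  (forall z z', (forall e, (z e).1 = (z' e).1) -> (forall e, ~~ b e -> z e = z' e) ->
     F z = F z') ->
  mean (fun z => cos (F z)) ^+ 2 + mean (fun z => sin (F z)) ^+ 2 <=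
  mean (fun z => cos (F z - F (swap_copies b z))).
Proof.
move=> Fb.
rewrite (mean_splice b (fun z => cos _)) (mean_splice b (fun z => sin _)).
apply: le_trans (lerD (iid_mean_sqr_le bern2_ge0 bern2_sum1 _)
                      (iid_mean_sqr_le bern2_ge0 bern2_sum1 _)) _.
rewrite -iid_meanD.
pose G z z' z'' := cos (F (splice b z z') - F (splice b z z'')).
apply: (@le_trans _ _ (mean (fun z => mean (fun z' => mean (G z z'))))).
  apply: le_iid_mean => [v|z]; first exact: bern2_ge0.
  rewrite !expr2 -!iid_meanZr -iid_meanD le_eqVlt; apply/orP; left; apply/eqP.
  apply: eq_iid_mean => z'; rewrite -!iid_meanZ -iid_meanD.
  by apply: eq_iid_mean => z''; rewrite /G cosB.
(* The two resampled values of [x_e], for [e] in [b], are the first components of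
   the two fresh copies; paired, they have the law of a coordinate. *)
under eq_iid_mean => z do rewrite (iid_mean_pair bern2 bern2 (G z)).
rewrite (iid_mean_pair bern2 (prodw bern2 bern2)
  (fun z u => G z [ffun e => (u e).1] [ffun e => (u e).2])).
rewrite -(iid_mean_map (w := prodw bern2 (prodw bern2 bern2))
  (g := fun e v => if b e then (v.2.1.1, v.2.2.1) else v.1)); last first.
  move=> e [u1 u2]; rewrite big_cond; do ![rewrite big_pairE/= | rewrite big_bool/=].
  rewrite /bern2 /prodw /bern /=.
  by case: (b e); case: u1; case: u2; rewrite !xpair_eqE/=; ring.
rewrite le_eqVlt; apply/orP; left; apply/eqP; apply: eq_iid_mean => u.
rewrite /G; congr (cos (_ - _)); apply: Fb => e; rewrite !ffunE/=;
  by case: (b e) => //; rewrite ?ffunE.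
Qed.


Section Polynomial.
Variables (Lb : eqType) (lab : E -> Lb) (T : finType) (Q : pred T).
Variables (P : T -> {set E}) (s : R).
Implicit Types (ls : seq Lb) (l : Lb).

Definition off_part ls z (t : T) : R :=
  \prod_(e in P t | lab e \notin ls) ((z e).1)%:R.

Definition block_diff z (t : T) l : R :=
  \prod_(e in P t | lab e == l) ((z e).1)%:R - \prod_(e in P t | lab e == l) ((z e).2)%:R.

(** The polynomial [\sum_t \prod_(e in P t) x_e] after decoupling the blocks
    labelled by [ls]: the alternating sum over the exchanges of the two copies
    of each of these blocks. *)
Definition decoupled ls z : R :=
  \sum_(t | Q t) off_part ls z t * \prod_(l <- ls) block_diff z t l.

Lemma decoupled_nil z : decoupled [::] z = \sum_(t | Q t) \prod_(e in P t) ((z e).1)%:R.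
Proof.
apply: eq_bigr => t _; rewrite big_nil mulr1; apply: eq_bigl => e.
by rewrite andbT.
Qed.

Lemma decoupled_cons l ls z : l \notin ls ->
  decoupled (l :: ls) z = decoupled ls z - decoupled ls (swap_copies (fun e => lab e == l) z).
Proof.
move=> lls; rewrite -sumrB; apply: eq_bigr => t _; rewrite big_cons.
have -> : \prod_(j <- ls) block_diff (swap_copies (fun e => lab e == l) z) t j =
          \prod_(j <- ls) block_diff z t j.
  apply: eq_big_seq => j jls; have jl : j == l = false.
    by apply: contraNF lls => /eqP <-.
  by congr (_ - _); apply: eq_bigr => e /andP[_ /eqP ej]; rewrite ffunE ej jl.
rewrite -mulrBl mulrA; congr (_ * _).
have split_off (z' : {ffun E -> bool * bool}) : off_part ls z' t =
    off_part (l :: ls) z' t * \prod_(e in P t | lab e == l) ((z' e).1)%:R.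
  rewrite /off_part (bigID (fun e => lab e == l))/= mulrC; congr (_ * _).
    by apply: eq_bigl => e; rewrite inE negb_or -!andbA; congr (_ && _); rewrite andbC.
  apply: eq_bigl => e; case: (lab e =P l) => [->|]; rewrite ?andbF// !andbT.
  by rewrite lls andbT.
rewrite !split_off /block_diff mulrBr; congr (_ * _ - _ * _).
  apply: eq_bigr => e /andP[_]; rewrite inE negb_or => /andP[/negbTE el _].
  by rewrite ffunE el.
by apply: eq_bigr => e /andP[_ el]; rewrite ffunE el.
Qed.

Lemma decoupled_ext l ls z z' : l \notin ls ->
  (forall e, (z e).1 = (z' e).1) -> (forall e, lab e != l -> z e = z' e) ->
  decoupled ls z = decoupled ls z'.
Proof.
move=> lls z1 z2; apply: eq_bigr => t _; congr (_ * _).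
  by apply: eq_bigr => e _; rewrite z1.
apply: eq_big_seq => j jls; have jl : j != l by apply: contraNneq lls => <-.
by congr (_ - _); apply: eq_bigr => e /andP[_ /eqP ej]; rewrite z2// ej.
Qed.

(** The squared modulus of the mean of [exp (i s decoupled)]. *)
Definition mod_sqr ls : R := mean (fun z => cos (s * decoupled ls z)) ^+ 2 +
               mean (fun z => sin (s * decoupled ls z)) ^+ 2.

Lemma mod_sqr_step l ls : l \notin ls ->
  mod_sqr ls <= mean (fun z => cos (s * decoupled (l :: ls) z)).
Proof.
move=> lls; have := @decoupling_step (fun e => lab e == l) (fun z => s * decoupled ls z).
have h z z' : (forall e, (z e).1 = (z' e).1) ->
    (forall e, ~~ (lab e == l) -> z e = z' e) -> s * decoupled ls z = s * decoupled ls z'.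
  by move=> h1 h2; rewrite (decoupled_ext lls h1 h2).
move=> /(_ h) /le_trans; apply; rewrite le_eqVlt; apply/orP; left; apply/eqP.
by apply: eq_iid_mean => z; rewrite decoupled_cons// mulrBr.
Qed.

Lemma mod_sqr_ge0 ls : 0 <= mod_sqr ls. Proof. by rewrite addr_ge0// sqr_ge0. Qed.

Lemma mod_sqr_iter ls : uniq ls -> mod_sqr [::] ^+ (2 ^ size ls) <= mod_sqr ls.
Proof.
elim: ls => [|l ls IH] /=; first by rewrite expn0 expr1.
case/andP=> lls uls; rewrite expnS mulnC exprM.
apply: (@le_trans _ _ (mod_sqr ls ^+ 2)).
  by apply: lerXn2r; rewrite ?nnegrE ?exprn_ge0 ?mod_sqr_ge0 ?IH.
apply: (@le_trans _ _ (mean (fun z => cos (s * decoupled (l :: ls) z)) ^+ 2)).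
  have h := mod_sqr_step lls.
  by apply: lerXn2r; rewrite ?nnegrE// (le_trans (mod_sqr_ge0 ls)).
by rewrite /mod_sqr lerDl sqr_ge0.
Qed.

Lemma decoupling l ls : uniq (l :: ls) ->
  mod_sqr [::] ^+ (2 ^ size ls) <= mean (fun z => cos (s * decoupled (l :: ls) z)).
Proof. by case/andP=> lls uls; apply: le_trans (mod_sqr_iter uls) (mod_sqr_step lls). Qed.

End Polynomial.

End Decoupling.

(** * Integrating out the last block *)

Section RademacherSum.
Variables (R : realType) (E : finType) (p : R).

(** The symmetric variable [x_e - x'_e]. *)
Definition ydiff (v : bool * bool) : R := v.1%:R - v.2%:R.

Lemma expiD (x y : R) : expi (x + y) = expi x * expi y.
Proof.
by rewrite /expi cosD sinD; apply/eqP; rewrite eq_complex/= eqxx/= addrC.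
Qed.

Lemma expi0 : expi (0 : R) = 1.
Proof. by rewrite /expi cos0 sin0. Qed.

Lemma expi_sum (I : finType) (F : I -> R) : expi (\sum_i F i) = \prod_i expi (F i).
Proof. by rewrite (big_morph _ expiD expi0). Qed.

(** The characteristic function of a sum of independent symmetric variables
    with values in [{-1, 0, 1}]; it is real because they are symmetric. *)
Lemma mean_cos_sum (c : E -> R) :
  iid_mean (bern2 p) (fun z : {ffun E -> bool * bool} => cos (\sum_e c e * ydiff (z e))) =
  \prod_e (1 - 2 * p * (1 - p) * (1 - cos (c e))).
Proof.
have factor e : \sum_v (bern2 p v)%:C%C * expi (c e * ydiff v) =
    (1 - 2 * p * (1 - p) * (1 - cos (c e)))%:C%C.
  do ![rewrite big_pairE/= | rewrite big_bool/=].
  rewrite /ydiff /bern2 /prodw /bern /expi /= !subrr sub0r subr0 mulr0 mulrN1 mulr1.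
  rewrite cosN sinN cos0 sin0; apply/eqP; rewrite eq_complex/=.
  by apply/andP; split; apply/eqP; ring.
have : \prod_e (1 - 2 * p * (1 - p) * (1 - cos (c e)))%:C%C =
   \sum_(z : {ffun E -> bool * bool}) (\prod_e bern2 p (z e))%:C%C * expi (\sum_e c e * ydiff (z e)).
  under eq_bigr do rewrite -factor.
  rewrite bigA_distr_bigA; apply: eq_bigr => z _.
  by rewrite big_split expi_sum rmorph_prod.
rewrite -rmorph_prod => /(congr1 (@complex.Re R))/= ->.
rewrite (raddf_sum (@complex.Re R)); apply: eq_bigr => z _.
by rewrite /expi /= mul0r subr0.
Qed.

End RademacherSum.

Section SpineBound.
Variables (R : realType) (r N : nat) (E : finType) (D0 : {set 'I_r}).
Variable edge : {set 'I_r} -> {ffun 'I_r -> 'I_N} -> E.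
Implicit Types (D : {set 'I_r}) (f g : {ffun 'I_r -> 'I_N}) (z : {ffun E -> bool * bool}).
Hypothesis card_D0 : #|D0| = 2%N.
Hypothesis edge_inj : forall D (D' : {set 'I_r}) f g, #|D| = 2%N -> #|D'| = 2%N ->
  edge D f = edge D' g -> D = D' /\ {in D, f =1 g}.
Variables (p s : R).
Hypothesis p01 : 0 <= p <= 1.

Local Notation spine := (spine D0 edge).
Local Notation other_pairs := (other_pairs D0).
Let q : R := 2 * p * (1 - p).

(** The edges on which the two copies differ; they are independent of each other
    and have probability [2 p (1 - p)]. *)
Definition support z : {ffun E -> bool} := [ffun e => (z e).1 != (z e).2].

(** The alternating sum left over when all the blocks are decoupled. *)
Definition alt_count z : R :=
  \sum_f \prod_(D : {set 'I_r} | #|D| == 2%N) ydiff R (z (edge D f)).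

Definition spine_weight z f : R := \prod_(D in other_pairs) ydiff R (z (edge D f)).

Definition ext_weight z (e : E) : R := \sum_(f | edge D0 f == e) spine_weight z f.

Definition ext_num z (e : E) : nat :=
  #|[set f : {ffun 'I_r -> 'I_N} | (edge D0 f == e) && covers (support z) (spine f)]|.

Let q01 : 0 <= q <= 1.
Proof.
case/andP: p01 => p0 p1; rewrite /q; apply/andP; split; first by nra.
by have := sqr_ge0 (1 - 2 * p); rewrite expr2; nra.
Qed.

Lemma alt_countE z : alt_count z = \sum_f ydiff R (z (edge D0 f)) * spine_weight z f.
Proof.
apply: eq_bigr => f _; rewrite (bigD1 D0)/= ?card_D0//; congr (_ * _).
by apply: eq_bigl => D; rewrite inE.
Qed.

Lemma edge_D0_other_pair D f g : D \in other_pairs -> edge D f != edge D0 g.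
Proof.
rewrite inE => /andP[/eqP D2]; apply: contra => /eqP e.
by have [->] := edge_inj D2 card_D0 e.
Qed.

(** Given the coordinates off the block of [D0], the alternating sum is a
    linear form in the independent signs of that block. *)
Lemma mean_cos_alt_count :
  iid_mean (bern2 p) (fun z => cos (s * alt_count z)) =
  iid_mean (bern2 p) (fun z => \prod_e (1 - q * (1 - cos (s * ext_weight z e)))).
Proof.
pose b (e : E) := [exists f, edge D0 f == e].
rewrite (mean_splice p b); apply: eq_iid_mean => z.
rewrite /q -mean_cos_sum; apply: eq_iid_mean => z'; congr cos.
have -> : alt_count (splice b z z') =
    \sum_f ydiff R (z' (edge D0 f)) * spine_weight z f.
  rewrite alt_countE; apply: eq_bigr => f _; congr (_ * _).
    rewrite ffunE ifT//; by apply/existsP; exists f.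
  apply: eq_bigr => D Dp; rewrite ffunE ifF//; apply/existsP => -[g /eqP e].
  by have := edge_D0_other_pair f g Dp; rewrite e eqxx.
rewrite (partition_big (edge D0) predT)//= mulr_sumr; apply: eq_bigr => e _.
rewrite -mulrA; congr (_ * _); rewrite /ext_weight mulr_suml.
by apply: eq_bigr => f /eqP ->; rewrite mulrC.
Qed.

Lemma spine_weight_covers z f :
  if covers (support z) (spine f) then `|spine_weight z f| = 1 else spine_weight z f = 0.
Proof.
case: ifP => [/forall_inP zf|/negbT].
  rewrite normr_prod big1// => D Dp.
  have := zf (edge D f) (imset_f _ Dp); rewrite ffunE /ydiff.
  by case: (z _) => -[] [] //= _; rewrite ?subr0 ?sub0r ?normrN1 ?normr1.
rewrite negb_forall => /existsP[e]; rewrite negb_imply => /andP[/imsetP[D Dp ->]].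
rewrite ffunE negbK => /eqP e12.
by rewrite /spine_weight (bigD1 D)//= /ydiff e12 subrr mul0r.
Qed.

Lemma cos_ext_weight z e : ext_num z e = 1%N -> cos (s * ext_weight z e) = cos s.
Proof.
move=> /eqP/cards1P[f0 Hf0].
have hf f : (edge D0 f == e) && covers (support z) (spine f) = (f == f0).
  by have /setP/(_ f) := Hf0; rewrite !inE.
have -> : ext_weight z e = spine_weight z f0.
  have /andP[e0 _] : (edge D0 f0 == e) && covers (support z) (spine f0) by rewrite hf.
  rewrite /ext_weight (bigD1 f0)//= big1 ?addr0// => f /andP[fe ff0].
  have := spine_weight_covers z f; case: ifP => // zf.
  by have := hf f; rewrite fe zf (negbTE ff0).
have := spine_weight_covers z f0; have := hf f0; rewrite eqxx => /andP[_ ->].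
case: (ler0P (spine_weight z f0)) => _ => [h|->]; last by rewrite mulr1.
by rewrite -[spine_weight z f0]opprK h mulrN1 cosN.
Qed.

Lemma ext_num_sum z e : (ext_num z e)%:R =
  \sum_(f | edge D0 f == e) (covers (support z) (spine f))%:R :> R.
Proof.
rewrite /ext_num -sum1_card natr_sum big_mkcond [RHS]big_mkcond/=.
by apply: eq_bigr => f _; rewrite inE; case: (_ == e); case: (covers _ _).
Qed.

(** A Bonferroni inequality for the edges with exactly one completion:
    [k - k (k - 1)] is at most [1], and at most [0] unless [k = 1]. *)
Lemma ext_num_count z :
  spine_count R D0 edge (support z) - twin_count R D0 edge (support z) <=
  \sum_e (ext_num z e == 1%N)%:R.
Proof.
set h := support z; pose I f : R := (covers h (spine f))%:R.
have II f : I f * I f = I f by rewrite /I; case: (covers _ _); rewrite ?mulr1 ?mulr0.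
have S1 : spine_count R D0 edge h = \sum_e (ext_num z e)%:R.
  rewrite /spine_count (partition_big (edge D0) predT)//=.
  by apply: eq_bigr => e _; rewrite ext_num_sum.
have S2 : spine_count R D0 edge h + twin_count R D0 edge h = \sum_e (ext_num z e)%:R ^+ 2.
  have -> : \sum_e (ext_num z e)%:R ^+ 2 =
      \sum_f \sum_g (if edge D0 f == edge D0 g then I f * I g else 0).
    under eq_bigr do rewrite expr2 ext_num_sum mulr_suml.
    rewrite [RHS](partition_big (edge D0) predT)//=; apply: eq_bigr => e _.
    apply: eq_bigr => f /eqP fe; rewrite mulr_sumr -big_mkcond/=.
    by apply: eq_bigl => g; rewrite fe eq_sym.
  have -> : twin_count R D0 edge h =
      \sum_f \sum_g (if twins D0 edge (f, g) then I f * I g else 0).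
    rewrite pair_big/= /twin_count big_mkcond/=; apply: eq_bigr => -[f g] _ /=.
    by case: ifP => // _; rewrite coversU -mulnb natrM.
  rewrite /spine_count -big_split/=; apply: eq_bigr => f _.
  rewrite [RHS](bigD1 f)//= eqxx II; congr (_ + _).
  rewrite (bigD1 f)//= /twins/= eqxx add0r; apply: eq_bigr => g gf.
  by rewrite eq_sym gf.
have -> : twin_count R D0 edge h = \sum_e (ext_num z e)%:R ^+ 2 - \sum_e (ext_num z e)%:R.
  by rewrite -S1 -S2 addrAC subrr add0r.
rewrite S1 -!sumrB; apply: ler_sum => e _; case: (ext_num z e) => [|[|k]].
- by rewrite expr0n/= !subr0.
- by rewrite expr1n subrr subr0.
- rewrite /= expr2; have : 2 <= (k.+2)%:R :> R by rewrite ler_nat.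
  nra.
Qed.

(** Only the edges with exactly one completion are used, the other factors being
    at most [1]. *)
Lemma prod_ext_le z : 0 <= 1 - cos s ->
  \prod_e (1 - q * (1 - cos (s * ext_weight z e))) <=
  expR (- (q * (1 - cos s) *
   (spine_count R D0 edge (support z) - twin_count R D0 edge (support z)))).
Proof.
move=> cs; case/andP: q01 => q0 q1.
have c2 (x : R) : 0 <= 1 - cos x <= 2 by have := cos_le1 x; have := cos_geN1 x; lra.
apply: (@le_trans _ _ (\prod_e expR (- (q * (1 - cos s) * (ext_num z e == 1%N)%:R)))).
  apply: ler_prod => e _; apply/andP; split.
    have : q <= 1 / 2.
      by rewrite /q; have := sqr_ge0 (1 - 2 * p); rewrite expr2; lra.
    by have /andP[] := c2 (s * ext_weight z e); nra.
  apply: le_trans (expR_ge1Dx _) _; rewrite ler_expR lerN2.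
  case: eqP => [h|_]; first by rewrite cos_ext_weight// mulr1.
  by rewrite mulr0; apply: mulr_ge0 => //; case/andP: (c2 (s * ext_weight z e)).
have a0 : 0 <= q * (1 - cos s) by apply: mulr_ge0.
rewrite -expR_sum ler_expR sumrN -mulr_sumr lerN2 ler_wpM2l//.
exact: ext_num_count.
Qed.

Lemma mean_support (F : {ffun E -> bool} -> R) :
  iid_mean (bern2 p) (fun z => F (support z)) = iid_mean (bern q) F.
Proof.
rewrite -(iid_mean_map (w := bern2 p) (g := fun e v => v.1 != v.2))//.
move=> e u; rewrite big_cond; do ![rewrite big_pairE/= | rewrite big_bool/=].
by rewrite /bern2 /prodw /bern /q; case: u => /=; ring.
Qed.

(** Outside the two exceptional events there are at least [mu / 2 - mu / 4] edges
    with exactly one completion. *)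
Lemma mean_cos_le (mu d1 d2 : R) : 0 <= mu ->
  iid_mean (bern q) (fun h => ((spine_count R D0 edge h <= mu / 2)%R)%:R) <= d1 ->
  iid_mean (bern q) (fun h => ((mu / 4 <= twin_count R D0 edge h)%R)%:R) <= d2 ->
  iid_mean (bern2 p) (fun z => cos (s * alt_count z)) <=
  d1 + d2 + expR (- (q * (1 - cos s) * (mu / 4))).
Proof.
move=> mu0 H1 H2; case/andP: q01 => q0 q1.
have cs : 0 <= 1 - cos s by rewrite subr_ge0 cos_le1.
rewrite mean_cos_alt_count.
pose pr z : R := \prod_e (1 - q * (1 - cos (s * ext_weight z e))).
have pr1 z : pr z <= 1.
  apply: prodr_ile1 => e _; have := cos_le1 (s * ext_weight z e).
  have := cos_geN1 (s * ext_weight z e); move: (cos _) => c c1 c2.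
  have : q <= 1 / 2 by rewrite /q; have := sqr_ge0 (1 - 2 * p); rewrite expr2; lra.
  by move=> q2; apply/andP; split; nra.
set x := expR _.
have step z : pr z <= ((spine_count R D0 edge (support z) <= mu / 2)%R)%:R +
    ((mu / 4 <= twin_count R D0 edge (support z))%R)%:R + x.
  have x0 : 0 <= x by exact: expR_ge0.
  have := pr1 z; have := prod_ext_le z cs; rewrite -/(pr z).
  case: (leP (spine_count _ _ _ _) _) => hs; case: (leP _ (twin_count _ _ _ _)) => ht /=;
    rewrite ?mulr1n ?mulr0n; try lra.
  move=> h _; rewrite !add0r (le_trans h)// /x ler_expR lerN2.
  apply: ler_wpM2l; [exact: mulr_ge0|lra].
apply: le_trans (le_iid_mean (bern2_ge0 p01) step) _.
rewrite !iid_meanD (iid_mean_cst _ (bern2_sum1 p)) lerD2r.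
rewrite (mean_support (fun h => ((spine_count R D0 edge h <= mu / 2)%R)%:R)).
by rewrite (mean_support (fun h => ((mu / 4 <= twin_count R D0 edge h)%R)%:R)) lerD.
Qed.

End SpineBound.

(** * Transversal cliques of the random graph *)

Section RandomGraph.
Variables (R : realType) (n : nat) (p : R).
Local Notation E := {set 'I_n}.

(** The sets that are not pairs of vertices are extra independent coordinates. *)
Lemma gnp_expectE (f : {set E} -> R) :
  gnp_expect p f = iid_mean (bern p) (fun x : {ffun E -> bool} => f [set e in pairs n | x e]).
Proof.
rewrite /iid_mean /gnp_expect.
rewrite (partition_big (fun x : {ffun E -> bool} => [set e in pairs n | x e]) (mem (graphs n)))/=.
  apply: eq_bigr => G GP; under [RHS]eq_bigr => x /eqP -> do [].
  rewrite -big_distrl/=; congr (_ * _).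
  have GP' : G \subset pairs n by move: GP; rewrite powersetE.
  rewrite (eq_bigl (fun x : {ffun E -> bool} => x \in family
      (fun e => [pred b | (e \in pairs n) ==> (b == (e \in G))]))).
    rewrite -(bigA_distr_big_dep (fun e b => (e \in pairs n) ==> (b == (e \in G)))
       (fun _ b => bern p b)).
    rewrite (bigID (mem (pairs n)))/= [X in _ = _ * X]big1 ?mulr1; last first.
      by move=> e /negbTE ->; rewrite bern_sum1.
    rewrite (bigID (mem G))/=; congr (_ * _).
      rewrite -prodr_const [RHS](eq_bigl (mem G)) => [|e]; last first.
        by rewrite /= andbC; case: (boolP (e \in G)) => // /(subsetP GP') ->.
      apply: eq_bigr => e eG; rewrite (subsetP GP' _ eG) eG/=.
      by rewrite (big_pred1 true)// => -[].
    rewrite -prodr_const; apply: eq_big => [e|e]; rewrite inE andbC// => /andP[eP eG].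
    by rewrite eP (negbTE eG)/= (big_pred1 false)// => -[].
  move=> x; apply/eqP/familyP => [<- e|h].
    by rewrite !inE; case: (#|e| == 2%N) => //=.
  apply/setP => e; have := h e; rewrite !inE.
  case: (boolP (e \in pairs n)) => [eP|eP].
    by move: (eP); rewrite inE => -> /= /eqP ->.
  by move: (eP); rewrite inE => /negbTE ->; rewrite (contraNF (subsetP GP' e) eP).
by move=> x _; rewrite powersetE; apply/subsetP => e; rewrite inE => /andP[].
Qed.

Definition clique_edges (S : {set 'I_n}) : {set E} := [set e in pairs n | e \subset S].

Lemma in_clique_edges e S : (e \in clique_edges S) = (#|e| == 2%N) && (e \subset S).
Proof. by rewrite !inE. Qed.

Lemma is_cliqueE (G : {set E}) (S : {set 'I_n}) :
  is_clique G S = (clique_edges S \subset G).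
Proof.
apply/forall_inP/subsetP => [h e|h u uS].
  rewrite in_clique_edges => /andP[/cards2P[x [y [xy ->]]] eS].
  have xS : x \in S by apply: (subsetP eS); rewrite !inE eqxx.
  have yS : y \in S by apply: (subsetP eS); rewrite !inE eqxx orbT.
  by have /forall_inP/(_ y yS) := h x xS; rewrite xy.
apply/forall_inP => v vS; apply/implyP => uv; apply: h.
by rewrite in_clique_edges cards2 uv; apply/subsetP => w; rewrite !inE => /orP[]/eqP->.
Qed.

Lemma num_cliquesE (r : nat) (x : {ffun E -> bool}) :
  (num_cliques r [set e in pairs n | x e])%:R =
  \sum_(S : {set 'I_n} | #|S| == r) \prod_(e in clique_edges S) (x e)%:R :> R.
Proof.
rewrite /num_cliques -sum1_card natr_sum big_mkcond [RHS]big_mkcond/=.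
apply: eq_bigr => S _; rewrite inE is_cliqueE; case: (#|S| == r) => //=.
case: (boolP (_ \subset _)) => [sub|nsub].
  rewrite big1// => e eS; have := subsetP sub e eS; by rewrite inE => /andP[_ ->].
have [e eS ex] : exists2 e, e \in clique_edges S & ~~ x e.
  case/subsetPn: nsub => e eS; move: (eS); rewrite in_clique_edges !inE => /andP[-> _] ex.
  by exists e.
by rewrite (bigD1 e)//= (negbTE ex) mul0r.
Qed.

Lemma normc_gnp (f : {set E} -> R) :
  ComplexField.Normc.normc (gnp_expectC p (fun G => expi (f G))) ^+ 2 =
  gnp_expect p (fun G => cos (f G)) ^+ 2 + gnp_expect p (fun G => sin (f G)) ^+ 2.
Proof.
have -> : gnp_expectC p (fun G => expi (f G)) =
   (gnp_expect p (fun G => cos (f G)) +i* gnp_expect p (fun G => sin (f G)))%C.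
  apply/eqP; rewrite eq_complex/= (raddf_sum (@complex.Re R)) (raddf_sum (@complex.Im R)).
  by apply/andP; split; apply/eqP; apply: eq_bigr => G _;
     rewrite /= ?mul0r ?subr0 ?addr0.
by rewrite /ComplexField.Normc.normc/= sqr_sqrtr// addr_ge0// sqr_ge0.
Qed.

Section Transversal.
Variables (r N : nat) (vtx : 'I_r -> 'I_N -> 'I_n).
Hypothesis r_ge3 : (3 <= r)%N.
Hypothesis vtx_inj : forall i j a b, vtx i a = vtx j b -> i = j /\ a = b.
Implicit Types (D : {set 'I_r}) (f g : {ffun 'I_r -> 'I_N}).

Definition tedge D f : E := [set vtx i (f i) | i in D].

(** The label of the block of [e]; the blocks are the edges labelled by two classes.
    An edge inside a class or leaving the classes has a smaller label. *)
Definition classes (e : E) : {set 'I_r} := [set i | [exists a, vtx i a \in e]].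

Lemma in_tedge D f i a : (vtx i a \in tedge D f) = (i \in D) && (f i == a).
Proof.
apply/imsetP/andP => [[j jD /vtx_inj[-> ->]]|[iD /eqP <-]]; first by [].
by exists i.
Qed.

Lemma classes_tedge D f : classes (tedge D f) = D.
Proof.
apply/setP => i; rewrite inE; apply/existsP/idP => [[a]|iD].
  by rewrite in_tedge => /andP[].
by exists (f i); rewrite in_tedge iD eqxx.
Qed.

Lemma tedge_inj D (D' : {set 'I_r}) f g :
  tedge D f = tedge D' g -> D = D' /\ {in D, f =1 g}.
Proof.
move=> e; have DD : D = D' by rewrite -(classes_tedge D f) e classes_tedge.
split=> // i iD; have : vtx i (f i) \in tedge D' g by rewrite -e in_tedge iD eqxx.
by rewrite in_tedge => /andP[_ /eqP ->].
Qed.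

Lemma card_tedge D f : #|tedge D f| = #|D|.
Proof. by apply: card_in_imset => i j _ _ /vtx_inj[]. Qed.

Definition class_pairs : seq {set 'I_r} := enum [set D : {set 'I_r} | #|D| == 2%N].

Lemma tedge_setT_inj : injective (fun f => tedge [set: 'I_r] f).
Proof. by move=> f g /tedge_inj[_ h]; apply/ffunP => i; apply: h; rewrite inE. Qed.

Lemma sub_tedge_setT (e : E) f : e \subset tedge [set: 'I_r] f ->
  e = tedge (classes e) f.
Proof.
move=> sub; apply/setP => v; apply/idP/idP => [ve|].
  have /imsetP[i _ vE] := subsetP sub v ve.
  rewrite vE in_tedge eqxx andbT inE; apply/existsP; exists (f i); by rewrite -vE.
case/imsetP=> i; rewrite inE => /existsP[a ae] ->.
have := subsetP sub _ ae; rewrite in_tedge => /andP[_ /eqP fa].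
by rewrite fa.
Qed.

(** Only transversal cliques have an edge in each of the blocks, and these
    have exactly one edge in each block. *)
Lemma decoupled_cliques (z : {ffun E -> bool * bool}) :
  decoupled R classes (fun S : {set 'I_n} => #|S| == r) clique_edges class_pairs z =
  alt_count R tedge z.
Proof.
rewrite /decoupled /alt_count (bigID (mem [set tedge [set: 'I_r] f | f in predT]))/=.
rewrite [X in _ + X]big1 ?addr0; last first.
  move=> S /andP[/eqP Sr Snot].
  (* If [S] had an edge in every block, it would have a vertex in each class. *)
  have /existsP[D /andP[D2 /forall_inP hD]] : [exists D : {set 'I_r}, (#|D| == 2%N) &&
      [forall e in clique_edges S, classes e != D]].
    apply: contraR Snot; rewrite negb_exists => /forallP hn.
    have /fin_all_exists[f fS] i : exists a, vtx i a \in S.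
      have [j ji] : exists j, j != i.
        have /card_gt0P[j] : (0 < #|[set~ i]|)%N.
          by rewrite cardsC1 card_ord; case: (r) r_ge3 => // -[].
        by rewrite !inE => ji; exists j.
      have := hn [set i; j]; rewrite cards2 [i == j]eq_sym (negbTE ji) negb_forall => /existsP[e].
      rewrite negb_imply negbK => /andP[eS /eqP ce].
      have : i \in classes e by rewrite ce !inE eqxx.
      rewrite inE => /existsP[a ae]; exists a.
      by move: eS; rewrite in_clique_edges => /andP[_ /subsetP]; apply.
    apply/imsetP; exists (finfun f) => //; apply/esym/eqP.
    rewrite eqEcard card_tedge cardsT card_ord Sr leqnn andbT.
    by apply/subsetP => v /imsetP[i _ ->]; rewrite ffunE.
  have Dl : D \in class_pairs by rewrite mem_enum inE.
  have hD' e : (e \in clique_edges S) && (classes e == D) = false.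
    by case: (boolP (e \in _)) => //= /hD/negbTE.
  by rewrite (big_rem D)//= /block_diff !(eq_bigl _ _ hD') !big_pred0_eq subrr mul0r mulr0.
rewrite (eq_bigl (fun S => S \in [set tedge [set: 'I_r] f | f in predT])); last first.
  move=> S; apply: andb_idl => /imsetP[f _ ->].
  by rewrite card_tedge cardsT card_ord.
rewrite big_imset/=; last by move=> f g _ _; exact: tedge_setT_inj.
apply: eq_bigr => f _; rewrite /off_part big_pred0 ?mul1r; last first.
  move=> e; case: (boolP (e \in _)) => //=.
  rewrite in_clique_edges => /andP[e2 /sub_tedge_setT ef].
  by rewrite mem_enum inE -(card_tedge _ f) -ef e2.
rewrite /class_pairs big_enum/=; apply: eq_big => [D|D]; rewrite inE// => /eqP D2.
have hD e : (e \in clique_edges (tedge [set: 'I_r] f)) && (classes e == D) =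
    (e == tedge D f).
  apply/andP/eqP => [[]|->].
    by rewrite in_clique_edges => /andP[_ /sub_tedge_setT ->] /eqP; rewrite classes_tedge => ->.
  rewrite classes_tedge in_clique_edges card_tedge D2 eqxx; split=> //=.
  exact: imsetS (subsetT D).
by rewrite /block_diff !(eq_bigl _ _ hD) !big_pred1_eq.
Qed.

End Transversal.
End RandomGraph.

(** * The characteristic function for one number of vertices *)

Section CharacteristicFunction.
Variables (R : realType) (n r N : nat) (p s : R).
Hypothesis r_ge3 : (3 <= r)%N.
Hypothesis N_le : (r * N <= n)%N.
Hypothesis p01 : 0 <= p <= 1.
Local Notation E := {set 'I_n}.

Lemma vtx_subproof (i : 'I_r) (a : 'I_N) : (i * N + a < n)%N.
Proof.
apply: leq_trans N_le; apply: (@leq_trans (i.+1 * N)); last by rewrite leq_mul2r ltn_ord orbT.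
by rewrite mulSnr ltn_add2l.
Qed.

Definition vtx (i : 'I_r) (a : 'I_N) : 'I_n := Ordinal (vtx_subproof i a).

Lemma vtx_inj (i j : 'I_r) (a b : 'I_N) : vtx i a = vtx j b -> i = j /\ a = b.
Proof.
move=> /(congr1 val)/= e; have N0 : (0 < N)%N by apply: leq_trans (ltn_ord a).
have ij : i = j :> nat.
  by have := congr1 (divn^~ N) e; rewrite !divnMDl// !divn_small// !addn0.
split; apply: val_inj => //=.
by apply/eqP; rewrite -(eqn_add2l (i * N)) e ij.
Qed.

Let X (G : {set E}) : R := (num_cliques r G)%:R.

Lemma mean_first_copy (F : {ffun E -> bool} -> R) :
  iid_mean (bern p) F = iid_mean (bern2 p) (fun z => F [ffun e => (z e).1]).
Proof.
rewrite (iid_mean_map (w := bern2 p) (w' := bern p) (g := fun _ v => v.1))//.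
move=> e u; rewrite big_cond; do ![rewrite big_pairE/= | rewrite big_bool/=].
by rewrite /bern2 /prodw /bern; case: u => /=; ring.
Qed.

(** The first decoupling bounds the square of the modulus, whence [2 ^ 'C(r, 2)] for
    as many blocks. *)
Lemma normc_le_alt_count :
  ComplexField.Normc.normc (gnp_expectC p (fun G => expi (s * X G))) ^+ (2 ^ 'C(r, 2)) <=
  iid_mean (bern2 p) (fun z => cos (s * alt_count R (tedge vtx) z)).
Proof.
have szA : size (class_pairs r) = 'C(r, 2).
  by rewrite -cardE card_draws card_ord.
have uA : uniq (class_pairs r) by exact: enum_uniq.
have C0 : (0 < 'C(r, 2))%N by rewrite bin_gt0 (ltnW r_ge3).
have dE z := decoupled_cliques R r_ge3 vtx_inj z.
under eq_iid_mean => z do rewrite -dE.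
case Aeq : (class_pairs r) uA szA => [|l ls] uA szA; first by rewrite -szA in C0.
have := decoupling p01 (classes vtx) (fun S : {set 'I_n} => #|S| == r)
  (@clique_edges n) s uA.
apply: le_trans; rewrite -szA /= expnS exprM.
apply: lerXn2r; rewrite ?nnegrE ?sqr_ge0 ?mod_sqr_ge0//.
rewrite le_eqVlt; apply/orP; left; apply/eqP.
have XE (z : {ffun E -> bool * bool}) :
    X [set e in pairs n | [ffun e => (z e).1] e] =
    decoupled R (classes vtx) (fun S : {set 'I_n} => #|S| == r) (@clique_edges n) [::] z.
  rewrite /X num_cliquesE decoupled_nil; apply: eq_bigr => S _.
  by apply: eq_bigr => e _; rewrite ffunE.
by rewrite normc_gnp /mod_sqr; congr (_ ^+ 2 + _ ^+ 2); rewrite gnp_expectE mean_first_copy;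
  apply: eq_iid_mean => z; rewrite XE.
Qed.

(** The estimate of the characteristic function at one [n]: up to an
    exponentially small error, the decoupled sum behaves as if it had about
    [mu] independent summands, each switched on with probability [q]. *)
Lemma normc_le (q Y kappa mu : R) (m : nat) :
  q = 2 * p * (1 - p) ->
  0 <= kappa <= 1 -> 2 ^+ r * kappa <= 1 / 16 ->
  mu = N%:R ^+ r * q ^+ ('C(r, 2) - 1) ->
  Y ^+ 2 <= N%:R ^+ 2 * q ^+ (r - 2) -> Y <= mu ->
  N%:R ^+ 2 * q ^+ r.+1 <= kappa ^+ 2 ->
  (0 < m)%N ->
  32 * (2 ^+ r * (3 * ('C(r, 2) - 1) * m)%:R ^+ r) ^+ 2 <= Y ->
  ComplexField.Normc.normc (gnp_expectC p (fun G => expi (s * X G))) ^+ (2 ^ 'C(r, 2)) <=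
  expR (- m%:R) + 2^-1 ^+ m + expR (- (q * (1 - cos s) * (mu / 4))).
Proof.
move=> qE k01 ksmall muE H1 H2 H3 m0 HY.
apply: (le_trans normc_le_alt_count).
pose D0 : {set 'I_r} := [set Ordinal (ltnW (ltnW r_ge3)); Ordinal (ltnW r_ge3)].
have D02 : #|D0| = 2%N by rewrite cards2 -val_eqE.
have einj (D D' : {set 'I_r}) (f g : {ffun 'I_r -> 'I_N}) : #|D| = 2%N -> #|D'| = 2%N ->
  tedge vtx D f = tedge vtx D' g -> D = D' /\ {in D, f =1 g}.
  by move=> _ _; exact: (tedge_inj vtx_inj).
have q01 : 0 <= q <= 1.
  by rewrite qE; case/andP: p01 => p0 p1; apply/andP; split; nra.
have co : #|other_pairs D0| = ('C(r, 2) - 1)%N by exact: card_other_pairs.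
have muE' : mu = N%:R ^+ r * q ^+ #|other_pairs D0| by rewrite co.
have L_ge : (3 * #|other_pairs D0| * m <= 3 * ('C(r, 2) - 1) * m)%N by rewrite co.
have mu0 : 0 <= mu.
  by rewrite muE mulr_ge0 ?exprn_ge0//; case/andP: q01.
have T1 := spine_count_lower r_ge3 D02 einj q01 muE' H1 H2 m0 L_ge erefl HY.
have T2 := twin_count_upper r_ge3 D02 einj q01 k01 muE' H1 H2 H3 m0 L_ge erefl HY ksmall.
rewrite qE in T1 T2 *.
exact: (mean_cos_le D02 einj s p01 mu0 T1 T2).
Qed.

End CharacteristicFunction.

(** * Elementary estimates *)

Section Estimates.
Variable R : realType.
Implicit Types (p s u : R).

(** On [[0, 1]] by the mean value theorem, as [cos >= cos 1] there; beyond [1] by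
    monotonicity, as [pi / 2 < 2]. *)
Lemma sin_ge_linear x : 0 <= x <= pi / 2 -> cos 1 / 2 * x <= sin x :> R.
Proof.
case/andP=> x0 xpi.
have c1 : 0 < cos 1 :> R := cos1_gt0 R.
have chord (y : R) : 0 <= y <= 1 -> cos 1 * y <= sin y.
  case/andP=> y0 y1; have [->|yn0] := eqVneq y 0; first by rewrite mulr0 sin0.
  have yp : 0 < y by rewrite lt_neqAle eq_sym yn0.
  have [c] := @MVT R (@sin R) (@cos R) 0 y yp
    (fun x _ => is_derive_sin x) (continuous_subspaceT (@continuous_sin R)).
  rewrite in_itv/= => /andP[c0 cy]; rewrite sin0 !subr0 => ->.
  rewrite ler_wpM2r//.
  have pi2 := pi_ge2 R.
  by apply: ltW; rewrite ltr_cos ?in_itv/=; lra.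
have [x1|x1] := leP x 1.
  apply: le_trans (chord x _); last by rewrite x0.
  by rewrite ler_wpM2r//; lra.
have s1 : cos 1 <= sin 1 :> R by rewrite -[leLHS]mulr1 chord// ler01 lexx.
have p2 := @pihalf_lt2 R.
apply: (@le_trans _ _ (cos 1)); first by nra.
apply: (le_trans s1); apply: ltW; rewrite ltr_sin// ?in_itv/=; lra.
Qed.

Lemma one_sub_cos_ge s : 0 <= s <= pi -> cos 1 ^+ 2 / 8 * s ^+ 2 <= 1 - cos s.
Proof.
case/andP=> s0 spi.
have h : 0 <= s / 2 <= pi / 2 by lra.
have h1 := sin_ge_linear h.
have c1 : 0 < cos 1 :> R := cos1_gt0 R.
have -> : cos s = cos ((s / 2) *+ 2) by congr cos; rewrite -mulr_natr; lra.
rewrite cos_mulr2n; have := sin2cos2 (s / 2) => h2.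
have : (cos 1 / 2 * (s / 2)) ^+ 2 <= sin (s / 2) ^+ 2.
  by apply: lerXn2r; rewrite // nnegrE; nra.
rewrite h2; nra.
Qed.


(** Lower bounds for [N ^ a p ^ b], with the fractional exponents cleared by the
    power [r - 1].  Here [u ^+ W] stands for [n], so that the last but one hypothesis
    is the lower threshold [p >= n ^ (- 2 / (r - 1))] and [N] is at least
    [n / (2 u ^ 8)]. *)
Lemma count_ge (r W a b e : nat) (u N p : R) :
  (3 <= r)%N -> 1 <= u -> 0 <= p -> 0 <= N ->
  u ^+ (W - 8) <= 2 * N -> 1 <= u ^+ (2 * W) * p ^+ (r - 1) ->
  (e * (r - 1) + 2 * W * b <= (W - 8) * (a * (r - 1)))%N ->
  u ^+ e <= (2 * N) ^+ a * p ^+ b.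
Proof.
move=> r3 u1 p0 N0 hN hp he.
have u0 : 0 < u := lt_le_trans ltr01 u1.
have r1 : (0 < r - 1)%N by rewrite subn_gt0 (leq_trans _ r3).
have N2 : 0 <= 2 * N by rewrite mulr_ge0.
rewrite -(ler_pXn2r r1) ?nnegrE ?mulr_ge0 ?exprn_ge0 ?(ltW u0)//.
have ub : 0 < u ^+ (2 * W * b) by rewrite exprn_gt0.
rewrite -(ler_pM2r ub).
apply: (@le_trans _ _ ((2 * N) ^+ (a * (r - 1)))).
  rewrite -exprM -exprD.
  apply: (@le_trans _ _ ((u ^+ (W - 8)) ^+ (a * (r - 1)))).
    by rewrite -exprM ler_weXn2l.
  by apply: lerXn2r; rewrite ?nnegrE ?exprn_ge0 ?(ltW u0).
have -> : ((2 * N) ^+ a * p ^+ b) ^+ (r - 1) * u ^+ (2 * W * b) =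
   (2 * N) ^+ (a * (r - 1)) * (u ^+ (2 * W) * p ^+ (r - 1)) ^+ b.
  rewrite [(_ * p ^+ b) ^+ _]exprMn [(u ^+ _ * _) ^+ _]exprMn -!exprM.
  by rewrite -mulrA; congr (_ * _); rewrite mulrC (mulnC b).
by rewrite ler_peMr ?exprn_ge0// exprn_ege1.
Qed.

(** The exponential beats powers: the term of order [k.+1] of its series suffices. *)
Lemma expR_ge_pow (k W : nat) (l : R) : (0 < W)%N ->
  (W ^ k.+1 * k.+1`!)%:R <= l -> l ^+ k <= expR (l / W%:R).
Proof.
move=> W0 hl; have l0 : 0 <= l := le_trans (ler0n _ _) hl.
have Wp : 0 < W%:R :> R by rewrite ltr0n.
have h := @expR_ge1Dxn R (l / W%:R) k (divr_ge0 l0 (ltW Wp)).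
apply: (le_trans _ h); apply: (@le_trans _ _ ((l / W%:R) ^+ k.+1 / k.+1`!%:R)).
  rewrite expr_div_n -mulrA -invfM -natrX -natrM exprS mulrAC.
  have c0 : 0 < (W ^ k.+1 * k.+1`!)%:R :> R.
    by rewrite ltr0n muln_gt0 expn_gt0 W0 fact_gt0.
  by rewrite ler_peMl ?exprn_ge0// ler_pdivlMr// mul1r.
by rewrite lerDr.
Qed.

Lemma exp_error_le (m : nat) (a : R) : 2 * a + 2 <= m%:R ->
  expR (- m%:R) + 2^-1 ^+ m <= expR (- a).
Proof.
move=> h.
have h2 : 2^-1 <= expR (- 2^-1) :> R.
  by apply: le_trans (expR_ge1Dx _); lra.
have h3 : 2^-1 ^+ m <= expR (- (m%:R / 2)) :> R.
  have -> : - (m%:R / 2) = m%:R * - 2^-1 :> R by ring.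
  by rewrite expRM_natl; apply: lerXn2r; rewrite ?nnegrE ?expR_ge0 ?invr_ge0.
have m0 : 0 <= m%:R :> R by [].
have h4 : expR (- m%:R) <= expR (- (m%:R / 2)) :> R by rewrite ler_expR; lra.
have h5 : 2 <= expR 1 :> R by apply: le_trans (expR_ge1Dx _); lra.
apply: (@le_trans _ _ (2 * expR (- (m%:R / 2)))); first by lra.
apply: (@le_trans _ _ (expR 1 * expR (- (m%:R / 2)))).
  by rewrite ler_wpM2r ?expR_ge0.
by rewrite -expRD ler_expR; lra.
Qed.

Lemma ntilde_le (r n : nat) p : (0 < r)%N -> (r * ntilde r n p <= n)%N.
Proof.
move=> r0; rewrite mulnC -leq_divRL//; apply/bigmax_leqP => m _.
by rewrite -ltnS ltn_ord.
Qed.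

Lemma ntilde_lt (r n : nat) p : (3 <= r)%N -> 0 < ln (n%:R : R) ->
  (ntilde r n p)%:R ^+ (r - 2) * p ^+ ('C(r, 2) - 1) < (ln (n%:R : R)) ^- 10.
Proof.
move=> r3 l0; rewrite /ntilde.
pose P : pred 'I_(n %/ r).+1 := fun m =>
  (m%:R ^+ (r - 2) * p ^+ ('C(r, 2) - 1) < (ln (n%:R : R)) ^- 10)%R.
have P0 : (0 < #|P|)%N.
  apply/card_gt0P; exists ord0; rewrite unfold_in /P/= expr0n subn_eq0 leqNgt r3/= mul0r.
  by rewrite invr_gt0 exprn_gt0.
have [i iP ->] := eq_bigmax_cond (fun m : 'I_(n %/ r).+1 => nat_of_ord m) P0.
exact: iP.
Qed.

Lemma le_ntilde (r n m : nat) p : (m * r <= n)%N -> (0 < r)%N ->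
  m%:R ^+ (r - 2) * p ^+ ('C(r, 2) - 1) < (ln (n%:R : R)) ^- 10 ->
  (m <= ntilde r n p)%N.
Proof.
move=> mr r0 h; have mn : (m < (n %/ r).+1)%N by rewrite ltnS leq_divRL.
exact: (@leq_bigmax_cond _ _ (fun m : 'I_(n %/ r).+1 => nat_of_ord m) (Ordinal mn)).
Qed.

End Estimates.

(** * Large numbers of vertices *)

Lemma sq_pred k : (8 * k.+3 ^ 2 - 8 = 8 * (k.+2 * k.+4))%N.
Proof. 
have -> : (k.+3 ^ 2 = k.+2 * k.+4 + 1)%N by rewrite expnS expn1; lia.
by rewrite mulnDr addnK.
Qed.
(** The exponents for [N ^ 2 p ^ (r - 2)] and [N ^ r p ^ ('C(r, 2) - 1)] in
    [count_ge], with [W = 8 r ^ 2]. *)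
Lemma exponent_bound2 (r : nat) : (3 <= r)%N ->
  ((4 * r + 1) * (r - 1) + 2 * (8 * r ^ 2) * (r - 2) <= (8 * r ^ 2 - 8) * (2 * (r - 1)))%N.
Proof.
case: r => [|[|[|k]]]// _; rewrite sq_pred !subSS !subn0 expnS expn1.
suff -> : (8 * (k.+2 * k.+4) * (2 * k.+2) =
    (4 * k.+3 + 1) * k.+2 + 2 * (8 * (k.+3 * k.+3)) * k.+1 + (12 * (k * k) + 59 * k + 86))%N.
  exact: leq_addr.
by lia.
Qed.

Lemma exponent_bound_r (r c : nat) : (3 <= r)%N -> (c * 2 = r * (r - 1))%N ->
  ((2 * r + 1) * (r - 1) + 2 * (8 * r ^ 2) * (c - 1) <= (8 * r ^ 2 - 8) * (r * (r - 1)))%N.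
Proof.
move=> r3 c2.
have -> : (2 * (8 * r ^ 2) * (c - 1) = 8 * r ^ 2 * (r * (r - 1) - 2))%N.
  have -> : (r * (r - 1) - 2 = (c - 1) * 2)%N by rewrite -c2 mulnBl.
  by move: (c - 1)%N (r ^ 2)%N => a b; lia.
case: r r3 {c2} => [|[|[|k]]]// _; rewrite sq_pred.
have -> : (k.+3 - 1 = k.+2)%N by rewrite subn1.
have -> : (k.+3 * k.+2 - 2 = k.+1 * k.+4)%N.
  have -> : (k.+3 * k.+2 = k.+1 * k.+4 + 2)%N by lia.
  by rewrite addnK.
rewrite expnS expn1.
suff -> : (8 * (k.+2 * k.+4) * (k.+3 * k.+2) =
    (2 * k.+3 + 1) * k.+2 + 8 * (k.+3 * k.+3) * (k.+1 * k.+4) + (6 * (k * k) + 45 * k + 82))%N.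
  exact: leq_addr.
by lia.
Qed.

Lemma pronic_sub2 (r : nat) : (3 <= r)%N -> (r.+1 * (r - 2) = r * (r - 1) - 2)%N.
Proof.
case: r => [|[|[|k]]]// _.
have -> : (k.+3 - 1 = k.+2)%N by rewrite subn1.
have -> : (k.+3 - 2 = k.+1)%N by rewrite subn2.
have -> : (k.+3 * k.+2 = k.+4 * k.+1 + 2)%N by lia.
by rewrite addnK.
Qed.

Section LargeN.
Variables (R : realType) (r : nat).
Hypothesis r_ge3 : (3 <= r)%N.
Local Notation C := 'C(r, 2).

(** With [l = ln n], the scale [u = n ^ (1 / (8 r ^ 2))] dominates every
    power of [l], and all the quantities of the estimate are compared with
    integer powers of [u]. *)
Variables (n : nat) (p : R).
Let x : R := n%:R.
Let l : R := ln x.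
Let W : nat := (8 * r ^ 2)%N.
Let u : R := expR (l / W%:R).
Let N : nat := ntilde r n p.
Hypothesis p01 : 0 <= p <= 1.
Hypothesis p_lower : 1 <= x ^+ 2 * p ^+ (r - 1).
Hypothesis p_upper : p ^+ (C - 1) * x ^+ (r - 2) <= l ^+ (4 * r).
Hypothesis l_large : (W ^ (4 * r + 10).+1 * (4 * r + 10).+1`!)%:R <= l.
Hypothesis l_gt : 2 ^+ C < l.

Let p0 : 0 <= p. Proof. by case/andP: p01. Qed.

Let W_gt0 : (0 < W)%N.
Proof. by rewrite muln_gt0 expn_gt0 (leq_trans _ r_ge3). Qed.

Let C2 : (C * 2 = r * (r - 1))%N. Proof. exact: bin2_double. Qed.

Let l_ge1 : 1 <= l.
Proof. by apply: le_trans (ltW l_gt); rewrite exprn_ege1// ler1n. Qed.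

Lemma pow_l_le_u : l ^+ (4 * r + 10) <= u.
Proof. exact: expR_ge_pow. Qed.

Lemma l_le_u : l <= u.
Proof. by apply: le_trans pow_l_le_u; rewrite ler_eXnr// addn_gt0 orbT. Qed.

Let u_ge1 : 1 <= u. Proof. exact: le_trans l_le_u. Qed.
Let u_gt0 : 0 < u. Proof. exact: expR_gt0. Qed.

Let xE : x = u ^+ W.
Proof.
have x0 : 0 < x.
  rewrite ltNge; apply/negP => x0; have := l_ge1.
  by rewrite /l ln0//; lra.
rewrite /u -expRM_natl mulrCA divff ?mulr1 ?lnK ?posrE//.
by rewrite pnatr_eq0 -lt0n.
Qed.

Let W_gt8 : (8 < W)%N.
Proof.
rewrite /W; apply: (@leq_trans (8 * 3 ^ 2)) => //.
by rewrite leq_mul2l leq_exp2r.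
Qed.

(** Otherwise the upper threshold would bound a positive power of [n] by a power of
    [ln n]. *)
Lemma p_le_half : p <= 1 / 2.
Proof.
rewrite leNgt; apply/negP => hp.
have r2 : (0 < r - 2)%N by rewrite subn_gt0.
have h1 : (1 / 2) ^+ (C - 1) <= p ^+ (C - 1).
  by apply: lerXn2r; rewrite ?nnegrE ?(ltW hp)//; lra.
have h2 : u ^+ 2 <= x ^+ (r - 2).
  rewrite xE -exprM ler_weXn2l//; apply: (@leq_trans W); first exact: ltn_trans W_gt8.
  by rewrite leq_pmulr.
have h3 : l ^+ (4 * r) <= u.
  by apply: le_trans pow_l_le_u; rewrite ler_weXn2l// leq_addr.
have h4 : (1 / 2) ^+ (C - 1) * u ^+ 2 <= u.
  apply: le_trans h3; apply: le_trans p_upper.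
  by apply: ler_pM; rewrite ?exprn_ge0 ?(ltW u_gt0)//; lra.
have h5 : u <= 2 ^+ (C - 1).
  rewrite expr2 mulrA -[leRHS]mul1r in h4.
  have : (1 / 2) ^+ (C - 1) * u <= 1 by rewrite -(ler_pM2r u_gt0).
  by rewrite div1r exprVn mulrC ler_pdivrMr ?exprn_gt0// mul1r.
have h6 : 2 ^+ (C - 1) <= 2 ^+ C :> R by rewrite ler_weXn2l ?ler1n// leq_subr.
by have := lt_le_trans l_gt (le_trans l_le_u (le_trans h5 h6)); rewrite ltxx.
Qed.

(** The integer part of [n / u ^ 8] satisfies the condition defining [ntilde]: the upper
    threshold gives [(n / u ^ 8) ^ (r - 2) p ^ ('C(r, 2) - 1)] at most
    [(ln n) ^ (4 r) / u ^ 8], and [u] dominates the powers of [ln n]. *)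
Lemma ntilde_ge : u ^+ (W - 8) <= 2 * N%:R.
Proof.
have uW1 : 1 <= u ^+ (W - 8) by rewrite exprn_ege1.
have uW0 : 0 <= u ^+ (W - 8) := le_trans ler01 uW1.
set m0 := Num.truncn (u ^+ (W - 8)).
have /andP[m0le m0gt] := truncn_itv uW0; rewrite -/m0 in m0le m0gt.
have r_le_u : r%:R <= u.
  apply: le_trans l_le_u; apply: le_trans (ltW l_gt).
  rewrite -natrX ler_nat; apply: (leq_trans (ltnW (ltn_expl r (ltnSn 1)))).
  rewrite leq_exp2l//.
  have : (r * 2 <= C * 2)%N by rewrite C2 leq_mul2l ltn_subRL addn1 r_ge3 orbT.
  by rewrite leq_mul2r.
have m0n : (m0 * r <= n)%N.
  rewrite -(ler_nat R) natrM -/x xE.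
  have -> : u ^+ W = u ^+ (W - 8) * u ^+ 8 by rewrite -exprD subnK// ltnW.
  apply: ler_pM => //; apply: (le_trans r_le_u); exact: ler_eXnr.
have m0N : (m0 <= N)%N.
  apply: le_ntilde => //; first exact: leq_trans r_ge3.
  rewrite -/x -/l -div1r ltr_pdivlMr ?exprn_gt0 ?(lt_le_trans ltr01)//.
  have xr : 0 < x ^+ (r - 2) by rewrite xE !exprn_gt0.
  rewrite -(ltr_pM2r xr) mul1r.
  have -> : m0%:R ^+ (r - 2) * p ^+ (C - 1) * l ^+ 10 * x ^+ (r - 2) =
     m0%:R ^+ (r - 2) * (p ^+ (C - 1) * x ^+ (r - 2) * l ^+ 10) by ring.
  apply: (@le_lt_trans _ _ ((u ^+ (W - 8)) ^+ (r - 2) * u)).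
    apply: ler_pM; rewrite ?mulr_ge0 ?exprn_ge0 ?(le_trans ler01 l_ge1) ?ler0n//.
    - by apply: lerXn2r; rewrite ?nnegrE ?ler0n.
    - apply: le_trans pow_l_le_u; rewrite exprD ler_wpM2r ?exprn_ge0//.
      exact: le_trans ler01 l_ge1.
  have u1 : 1 < u.
    apply: lt_le_trans l_le_u; apply: le_lt_trans l_gt.
    by rewrite exprn_ege1// ler1n.
  rewrite xE -!exprM -exprSr ltr_eXn2l//.
  have r2 : (0 < r - 2)%N by rewrite subn_gt0.
  rewrite mulnBl; apply: (@leq_ltn_trans (W * (r - 2) - 8 * (r - 2) + 1)).
    by rewrite addn1.
  have : (8 * (r - 2) <= W * (r - 2))%N by rewrite leq_mul2r (ltnW W_gt8) orbT.
  clear -r2; move: (W * (r - 2))%N => a; lia.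
have m01 : (1 <= m0)%N.
  by rewrite -ltnS -(ltr_nat R) (le_lt_trans uW1).
have : (m0.+1%:R : R) <= 2 * N%:R.
  by rewrite -natrM ler_nat mul2n -addnn -addn1 leq_add// (leq_trans m01).
exact: le_trans (ltW m0gt).
Qed.

Let p_lower' : 1 <= u ^+ (2 * W) * p ^+ (r - 1).
Proof. by rewrite mulnC exprM -xE. Qed.

Variables (Y A q : R).
Hypothesis A_ge0 : 0 <= A.
Hypothesis Y_le : Y <= A * u ^+ (2 * r).
Hypothesis Y_ge0 : 0 <= Y.
Hypothesis A_small : 4 * A ^+ 2 <= u.
Hypothesis A_small' : 2 ^+ r * A <= u.
Hypothesis q_ge : p <= q.

(** [Y] is of the order of [u ^ (2 r)], which leaves a factor [u] to beat the
    constants here and in [mu_ge_ntilde]. *)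
Lemma sparse_subgraphs_ntilde : Y ^+ 2 <= N%:R ^+ 2 * q ^+ (r - 2).
Proof.
have h := count_ge r_ge3 u_ge1 p0 (ler0n R N) ntilde_ge p_lower' (exponent_bound2 r_ge3).
have h1 : Y ^+ 2 <= (A * u ^+ (2 * r)) ^+ 2.
  by apply: lerXn2r; rewrite ?nnegrE ?mulr_ge0 ?exprn_ge0 ?(ltW u_gt0).
have h2 : 4 * (A * u ^+ (2 * r)) ^+ 2 <= u ^+ (4 * r + 1).
  have -> : 4 * (A * u ^+ (2 * r)) ^+ 2 = u ^+ (4 * r) * (4 * A ^+ 2).
    by rewrite exprMn -exprM mulnAC; ring.
  by rewrite exprD expr1 ler_wpM2l// exprn_ge0// ltW.
have h3 : p ^+ (r - 2) <= q ^+ (r - 2).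
  by apply: lerXn2r; rewrite ?nnegrE// (le_trans p0).
have h4 : N%:R ^+ 2 * p ^+ (r - 2) <= N%:R ^+ 2 * q ^+ (r - 2).
  by rewrite ler_wpM2l ?exprn_ge0.
have h5 := le_trans h2 h; rewrite exprMn -mulrA in h5.
lra.
Qed.

Lemma mu_ge_ntilde : Y <= N%:R ^+ r * q ^+ (C - 1).
Proof.
have h := count_ge r_ge3 u_ge1 p0 (ler0n R N) ntilde_ge p_lower' (exponent_bound_r r_ge3 C2).
have h2 : 2 ^+ r * (A * u ^+ (2 * r)) <= u ^+ (2 * r + 1).
  by rewrite mulrA mulrC exprD expr1 ler_wpM2l// exprn_ge0// ltW.
have h3 : p ^+ (C - 1) <= q ^+ (C - 1).
  by apply: lerXn2r; rewrite ?nnegrE// (le_trans p0).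
apply: (le_trans Y_le).
apply: (@le_trans _ _ (N%:R ^+ r * p ^+ (C - 1))); last first.
  by rewrite ler_wpM2l ?exprn_ge0.
have h5 := le_trans h2 h; rewrite exprMn -mulrA ler_pM2l ?exprn_gt0// in h5.
Qed.

Variable kappa : R.
Hypothesis kappa0 : 0 < kappa.
Hypothesis q_le : q <= 2 * p.
Hypothesis l_kappa : (kappa ^+ 2 / 2 ^+ r.+1) ^- (r - 2) <= l.

(** The defining condition of [ntilde] bounds [N ^ (r - 2) p ^ ('C(r, 2) - 1)], the
    power [(r - 2) / 2] of [N ^ 2 p ^ (r + 1)], by [(ln n) ^ -10], which tends to
    zero. *)
Lemma few_extensions_ntilde : N%:R ^+ 2 * q ^+ r.+1 <= kappa ^+ 2.
Proof.
pose eta := kappa ^+ 2 / 2 ^+ r.+1.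
have eta0 : 0 < eta by rewrite divr_gt0 ?exprn_gt0.
have l0 : 0 < l := lt_le_trans ltr01 l_ge1.
have h : N%:R ^+ 2 * p ^+ r.+1 <= eta.
  have r2 : (0 < r - 2)%N by rewrite subn_gt0.
  rewrite -(ler_pXn2r r2) ?nnegrE ?mulr_ge0 ?exprn_ge0 ?(ltW eta0) ?(ltW kappa0)//.
  have -> : (N%:R ^+ 2 * p ^+ r.+1) ^+ (r - 2) = (N%:R ^+ (r - 2) * p ^+ (C - 1)) ^+ 2.
    rewrite [LHS]exprMn [RHS]exprMn -!exprM; congr (_ ^+ _ * _ ^+ _); first exact: mulnC.
    by rewrite mulnBl C2 mul1n pronic_sub2.
  have hl := ltW (ntilde_lt p r_ge3 l0); rewrite -/N -/x -/l in hl.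
  apply: (@le_trans _ _ ((l ^- 10) ^+ 2)).
    by apply: lerXn2r; rewrite ?nnegrE ?mulr_ge0 ?exprn_ge0 ?invr_ge0 ?exprn_ge0 ?(ltW l0).
  apply: (@le_trans _ _ (l^-1)).
    rewrite -exprVn -exprM -[leRHS]expr1 ler_wiXn2l ?invr_ge0 ?(ltW l0)//.
    by rewrite invf_le1.
  by rewrite invf_ple ?posrE ?exprn_gt0.
apply: (@le_trans _ _ (N%:R ^+ 2 * (2 * p) ^+ r.+1)).
  rewrite ler_wpM2l ?exprn_ge0//; apply: lerXn2r; rewrite ?nnegrE ?mulr_ge0//.
  exact: le_trans q_ge.
rewrite exprMn mulrCA; move: h; rewrite /eta ler_pdivlMr ?exprn_gt0//.
by rewrite mulrC.
Qed.

End LargeN.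

(** * The bound for large n *)

Section Conclusion.
Variables (R : realType) (r : nat).
Hypothesis r_ge3 : (3 <= r)%N.
Local Notation C := 'C(r, 2).

Lemma exprD_ge (a b : R) (k : nat) : 0 <= a -> 0 <= b ->
  a ^+ k.+1 + b ^+ k.+1 <= (a + b) ^+ k.+1.
Proof.
move=> a0 b0; elim: k => [|k IH]; first by rewrite !expr1.
rewrite [leRHS]exprS; apply: le_trans (ler_wpM2l (addr_ge0 a0 b0) IH).
rewrite !(exprS _ k.+1).
have h1 := mulr_ge0 a0 (exprn_ge0 k.+1 b0).
have h2 := mulr_ge0 b0 (exprn_ge0 k.+1 a0).
by rewrite mulrDl !mulrDr; lra.
Qed.

(** The factors: [cos 1 ^ 2 / 8] from [1 - cos s], [1 / 4] from the number of edges with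
    exactly one completion, and the root of order [2 ^ 'C(r, 2)]. *)
Definition cf_eps : R := cos 1 ^+ 2 / 8 / 4 / (2 ^ C)%:R.

Let bin_ge1 : (1 <= C)%N.
Proof. by rewrite bin_gt0 (ltnW r_ge3). Qed.

Lemma cf_eps_gt0 : 0 < cf_eps.
Proof.
by rewrite /cf_eps !divr_gt0// ?exprn_gt0 ?cos1_gt0// ltr0n expn_gt0.
Qed.

(** The thresholds enter in the form of polynomial inequalities, and largeness of [n] as
    [ln n >= L0].  The parameters of [normc_le] are [m], the integer part of
    [u = n ^ (1 / (8 r ^ 2))], the smallest admissible [Y], of the order of
    [m ^ (2 r)], and the largest admissible [kappa]. *)
Lemma normc_clique_cf_le (K : R) : 0 < K ->
  exists L0 : R, forall (n : nat) (p s : R), L0 <= ln (n%:R : R) ->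
  0 <= p <= 1 ->
  1 <= n%:R ^+ 2 * p ^+ (r - 1) ->
  p ^+ (C - 1) * n%:R ^+ (r - 2) <= ln (n%:R : R) ^+ (4 * r) ->
  0 <= s <= pi ->
  ComplexField.Normc.normc
    (gnp_expectC p (fun G : {set {set 'I_n}} => expi (s * (num_cliques r G)%:R))) <=
  n%:R `^ (- K) +
    expR (- (cf_eps * (ntilde r n p)%:R ^+ r * p ^+ C * s ^+ 2)).
Proof.
move=> K0.
pose M := (2 ^ C)%N.
pose A : R := 32 * (2 ^+ r * (3 * (C - 1))%:R ^+ r) ^+ 2.
pose kappa : R := 1 / 16 / 2 ^+ r.
pose W := (8 * r ^ 2)%N.
pose T1 : R := (W ^ (4 * r + 10).+1 * (4 * r + 10).+1`!)%:R.
pose T2 : R := 2 ^+ C.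
pose T3 : R := 4 * A ^+ 2.
pose T4 : R := 2 ^+ r * A.
pose T5 : R := (kappa ^+ 2 / 2 ^+ r.+1) ^- (r - 2).
pose T6 : R := 2 * (K * M%:R) + 4.
have two0 k : 0 < 2 ^+ k :> R by rewrite exprn_gt0.
have kappa0 : 0 < kappa by rewrite !divr_gt0.
have A0 : 0 <= A by rewrite mulr_ge0// sqr_ge0.
have T10 : 0 <= T1 by [].
have T20 : 0 <= T2 := ltW (two0 _).
have T30 : 0 <= T3 by rewrite mulr_ge0// sqr_ge0.
have T40 : 0 <= T4 := mulr_ge0 (ltW (two0 _)) A0.
have T50 : 0 <= T5 by rewrite invr_ge0 exprn_ge0// divr_ge0 ?sqr_ge0 ?(ltW (two0 _)).
have T60 : 0 <= T6 by rewrite addr_ge0// !mulr_ge0// ltW.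
exists (T1 + T2 + T3 + T4 + T5 + T6 + 1) => n p s hL p01 plow pup spi.
set l := ln _ in hL plow pup.
have l1 : T1 <= l by lra.
have l2 : T2 < l by lra.
have l3 : T3 <= l by lra.
have l4 : T4 <= l by lra.
have l5 : T5 <= l by lra.
have l6 : T6 <= l by lra.
have l_ge1 : 1 <= l by lra.
clear hL T10 T20 T30 T40 T50.
set u := expR (l / W%:R).
have lu : l <= u := l_le_u r_ge3 l1 l2.
have u1 : 1 <= u := le_trans l_ge1 lu.
have l2u : l ^+ 2 <= u.
  by apply: le_trans (pow_l_le_u r_ge3 l1); rewrite ler_weXn2l// ltn_addl.
pose m := Num.truncn u.
have /andP[m_le m_gt] := truncn_itv (le_trans ler01 u1); rewrite -/m in m_le m_gt.
have m0 : (0 < m)%N by rewrite -ltnS -(ltr_nat R) (le_lt_trans u1).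
pose q := 2 * p * (1 - p).
have ph := p_le_half r_ge3 p01 pup l1 l2.
have p0 : 0 <= p by case/andP: p01.
have qp : p <= q by rewrite /q; nra.
have q2p : q <= 2 * p by rewrite /q; nra.
pose Y : R := 32 * (2 ^+ r * (3 * (C - 1) * m)%:R ^+ r) ^+ 2.
have Y0 : 0 <= Y by rewrite mulr_ge0// sqr_ge0.
have Yle : Y <= A * u ^+ (2 * r).
  have -> : Y = A * m%:R ^+ (2 * r).
    rewrite /Y /A natrM [(_ * m%:R) ^+ r]exprMn (mulnC 2) exprM.
    by move: ((3 * (C - 1))%:R ^+ r) (m%:R ^+ r) (2 ^+ r) => b c d; ring.
  by rewrite ler_wpM2l//; apply: lerXn2r; rewrite ?nnegrE ?(le_trans ler01 u1).
set N := ntilde r n p.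
have H1 : Y ^+ 2 <= N%:R ^+ 2 * q ^+ (r - 2).
  exact: (sparse_subgraphs_ntilde r_ge3 p01 plow pup l1 l2 A0 Yle Y0 (le_trans l3 lu) qp).
have H2 : Y <= N%:R ^+ r * q ^+ (C - 1).
  exact: (mu_ge_ntilde r_ge3 p01 plow pup l1 l2 Yle (le_trans l4 lu) qp).
have H3 : N%:R ^+ 2 * q ^+ r.+1 <= kappa ^+ 2.
  exact: (few_extensions_ntilde r_ge3 p01 l2 qp kappa0 q2p l5).
have kE : 2 ^+ r * kappa = 1 / 16 by rewrite /kappa mulrC divfK// gt_eqF.
have k01 : 0 <= kappa <= 1.
  rewrite (ltW kappa0)/=; have : 1 <= 2 ^+ r :> R by rewrite exprn_ege1// ler1n.
  have := kappa0; move: kE; clear; move: (2 ^+ r) => a; nra.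
have rN : (r * N <= n)%N by apply: ntilde_le; exact: leq_trans r_ge3.
have ksmall : 2 ^+ r * kappa <= 1 / 16 by rewrite kE.
have := normc_le s r_ge3 rN p01 erefl k01 ksmall erefl H1 H2 H3 m0 (lexx Y).
rewrite -/q -/M; set phi := ComplexField.Normc.normc _ => main.
have phi0 : 0 <= phi by rewrite /phi; case: (gnp_expectC _ _) => a b; exact: sqrtr_ge0.
have M0 : (0 < M)%N by rewrite expn_gt0.
rewrite -(ler_pXn2r M0) ?nnegrE ?addr_ge0 ?powR_ge0 ?expR_ge0//.
apply: (le_trans main).
have [k Mk] : exists k, M = k.+1 by exists M.-1; rewrite prednK.
(* [a ^ M + b ^ M <= (a + b) ^ M] lets the root be taken term by term. *)
rewrite Mk; apply: le_trans (exprD_ge k (powR_ge0 _ _) (expR_ge0 _)); rewrite -Mk.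
have Mr : 0 < M%:R :> R by rewrite ltr0n.
rewrite lerD//.
  apply: (@le_trans _ _ (expR (- (K * M%:R * l)))).
    apply: exp_error_le.
    have h : T6 * l <= l ^+ 2 by rewrite expr2 ler_wpM2r// (le_trans ler01 l_ge1).
    rewrite /T6 in h; move: (K * M%:R) h => KM h.
    have : m%:R + 1 = m.+1%:R :> R by rewrite -natr1.
    by clear -h l2u m_gt l_ge1; nra.
  have n0 : n%:R != 0 :> R.
    by apply: contraTneq l_ge1 => n0; rewrite /l n0 ln0// -ltNge ltr01.
  rewrite /powR (negbTE n0) -/l -expRM_natl ler_expR.
  by rewrite le_eqVlt; apply/orP; left; apply/eqP; ring.
rewrite -expRM_natl ler_expR -/N.
have cs := one_sub_cos_ge spi.
have Np : N%:R ^+ r * p ^+ C <= q * (N%:R ^+ r * q ^+ (C - 1)).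
  have -> : q * (N%:R ^+ r * q ^+ (C - 1)) = N%:R ^+ r * q ^+ C.
    by rewrite mulrCA -exprS -subSn// subn1.
  by rewrite ler_wpM2l ?exprn_ge0//; apply: lerXn2r; rewrite ?nnegrE// (le_trans p0).
have c0 : 0 <= cos 1 ^+ 2 / 8 :> R by rewrite divr_ge0 ?sqr_ge0.
have Np0 : 0 <= N%:R ^+ r * p ^+ C by rewrite mulr_ge0 ?exprn_ge0.
have prodle := ler_pM (mulr_ge0 c0 (sqr_ge0 s)) Np0 cs Np.
rewrite mulrN lerN2 /cf_eps.
have -> : M%:R * (cos 1 ^+ 2 / 8 / 4 / (2 ^ C)%:R * N%:R ^+ r * p ^+ C * s ^+ 2) =
    (cos 1 ^+ 2 / 8 * s ^+ 2) * (N%:R ^+ r * p ^+ C) / 4.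
  by rewrite -/M; field; rewrite gt_eqF.
have -> : q * (1 - cos s) * (N%:R ^+ r * q ^+ (C - 1) / 4) =
    (1 - cos s) * (q * (N%:R ^+ r * q ^+ (C - 1))) / 4 by field.
by rewrite ler_pM2r// invr_gt0.
Qed.

End Conclusion.

(** * The thresholds as powers *)

Local Open Scope classical_set_scope.
Local Open Scope ring_scope.

Section Thresholds.
Variables (R : realType) (r : nat).
Hypothesis r_ge3 : (3 <= r)%N.
Implicit Types (x p l : R).

(** [1 / m(K_r) = 2 / (r - 1)]. *)
Lemma lower_threshold_pow x : 0 < x -> (x `^ (- (1 / mK R r))) ^+ (r - 1) = x ^- 2.
Proof.
move=> x0; rewrite -powR_mulrn ?powR_ge0// -powRrM -powR_invn ?ltW//.
congr (_ `^ _); rewrite /mK natrB ?(leq_trans _ r_ge3)//.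
have : 3 <= r%:R :> R by rewrite ler_nat.
by move=> h; field; lra.
Qed.

Lemma natr_bin2_sub1 : ('C(r, 2) - 1)%:R = (r%:R - 2) * (r%:R + 1) / 2 :> R.
Proof.
have h : ('C(r, 2) * 2 = r * (r - 1))%N := bin2_double r.
have C1 : (1 <= 'C(r, 2))%N by rewrite bin_gt0 (ltnW r_ge3).
have := congr1 (fun k : nat => k%:R : R) h.
rewrite !natrM !natrB// ?(leq_trans _ r_ge3)// => e.
lra.
Qed.

(** [1 / m_2(K_r) = 2 / (r + 1)], while ['C(r, 2) - 1 = (r - 2) (r + 1) / 2]. *)
Lemma upper_threshold_pow x l : 0 < x -> 0 < l ->
  (x `^ (- (1 / m2K R r)) * l `^ ((4 * r%:R) / ('C(r, 2)%:R - 1))) ^+ ('C(r, 2) - 1) =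
  x ^- (r - 2) * l ^+ (4 * r).
Proof.
move=> x0 l0; have r3 : 3 <= r%:R :> R by rewrite ler_nat.
have C1 : (1 <= 'C(r, 2))%N by rewrite bin_gt0 (ltnW r_ge3).
have cE : 'C(r, 2)%:R - 1 = ('C(r, 2) - 1)%:R :> R by rewrite natrB.
rewrite exprMn -[(x `^ _) ^+ _]powR_mulrn ?powR_ge0//.
rewrite -[(l `^ _) ^+ _]powR_mulrn ?powR_ge0// -!powRrM cE natr_bin2_sub1.
rewrite -powR_invn ?ltW// -(powR_mulrn _ (ltW l0)).
congr (_ `^ _ * _ `^ _).
  by rewrite /m2K natrB ?(ltnW r_ge3)//; field; lra.
by rewrite natrM; field; lra.
Qed.

End Thresholds.

Theorem lemma1p5 (R : realType) (r : nat) (hr : (3 <= r)%N) :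
  exists eps : R, 0 < eps /\
  forall (K : R) (p : nat -> R),
    0 < K ->
    (forall n : nat, 0 <= p n <= 1) ->
    much_less (fun n : nat => n%:R `^ (- (1 / mK R r))) p ->
    (\forall n \near \oo,
       p n <= n%:R `^ (- (1 / m2K R r)) *
              ln (n%:R : R) `^ ((4 * r%:R) / (('C(r, 2))%:R - 1))) ->
    \forall n \near \oo,
      forall t : R, 0 <= t <= pi * sd_cliques r n (p n) ->
        ComplexField.Normc.normc (char_cliques r n (p n) t) <=
          n%:R `^ (- K) +
          expR (- (eps * (ntilde r n (p n))%:R ^+ r * p n ^+ 'C(r, 2) * t ^+ 2
                   / sd_cliques r n (p n) ^+ 2)).
Proof.
exists (cf_eps R r); split; first exact: cf_eps_gt0.
move=> K p K0 p01 [pne0 fp] pup.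
have [L0 HL0] := normc_clique_cf_le hr K0.
have ratio : \forall n \near \oo, `|n%:R `^ (- (1 / mK R r)) / p n| < 1.
  by move/cvgr0Pnorm_lt : fp; apply.
have large : \forall n \near \oo, expR (Num.max L0 1) <= (n%:R : R).
  exact: nbhs_infty_ger.
near=> n.
move=> t /andP[t0 tle].
have nL : expR (Num.max L0 1) <= n%:R :> R by near: n.
have n0 : 0 < n%:R :> R := lt_le_trans (expR_gt0 _) nL.
have lL : Num.max L0 1 <= ln n%:R :> R by rewrite -ler_expR lnK.
have l1 : 1 <= ln n%:R :> R by apply: le_trans lL; rewrite le_max lexx orbT.
have lL0 : L0 <= ln n%:R :> R by apply: le_trans lL; rewrite le_max lexx.
have l0 : 0 < ln n%:R :> R := lt_le_trans ltr01 l1.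
have /andP[pn0 pn1] := p01 n.
have pn_gt0 : 0 < p n by rewrite lt_neqAle eq_sym pn0 andbT; near: n.
set sd := sd_cliques r n (p n) in tle *.
have sd0 : 0 <= sd by exact: sqrtr_ge0.
pose s := t / sd.
(* If [sd = 0] then [s = t / 0 = 0]. *)
have spi : 0 <= s <= pi.
  rewrite divr_ge0//=; have [sd_eq0|sdn0] := eqVneq sd 0.
    by rewrite /s sd_eq0 invr0 mulr0 pi_ge0.
  by rewrite ler_pdivrMr// lt_neqAle eq_sym sdn0.
have plow : 1 <= n%:R ^+ 2 * p n ^+ (r - 1).
  have : n%:R `^ (- (1 / mK R r)) <= p n.
    have : `|n%:R `^ (- (1 / mK R r)) / p n| < 1 by near: n.
    by rewrite ger0_norm ?divr_ge0 ?powR_ge0// ltr_pdivrMr// [ltRHS]mul1r => /ltW.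
  move=> /(lerXn2r (r - 1)); rewrite !nnegrE powR_ge0 pn0 => /(_ isT isT).
  by rewrite lower_threshold_pow// -[leLHS]mul1r ler_pdivrMr ?exprn_gt0// mulrC.
have pup' : p n ^+ ('C(r, 2) - 1) * n%:R ^+ (r - 2) <= ln (n%:R : R) ^+ (4 * r).
  have : p n <= n%:R `^ (- (1 / m2K R r)) *
              ln (n%:R : R) `^ ((4 * r%:R) / (('C(r, 2))%:R - 1)) by near: n.
  move=> /(lerXn2r ('C(r, 2) - 1)); rewrite !nnegrE mulr_ge0 ?powR_ge0// pn0 => /(_ isT isT).
  rewrite upper_threshold_pow// mulrC => h.
  by rewrite -ler_pdivlMr ?exprn_gt0// mulrC.
have := HL0 n (p n) s lL0 (p01 n) plow pup' spi.
rewrite /s expr_div_n mulrA.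
congr (ComplexField.Normc.normc _ <= _).
apply: eq_bigr => G _; congr (_ * expi _).
by rewrite mulrAC.
Unshelve. all: by end_near.
Qed.
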